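(* In the setting of the context, the following assertions hold. (i) For every $t\in[0,T]$, every $k\in\mathbb N$ and every $i=1,\dots,r$, the set $C_i(t,k)$ is compact and $C_i(t,k)\subset\mathrm{int}\,C_i(t)$. (ii) For every $i=1,\dots,r$, $\displaystyle \sup_{t\in[0,T]}\ \sup_{c\in\mathrm{bdry}\,C_i(t)}d\big(c,\mathrm{bdry}\,C_i(t,k)\big)\longrightarrow0$ as $k\to\infty$. (iii) There exists $k_1\in\mathbb N$ such that for all $k\ge k_1$, every $t\in[0,T]$ and every $i\in\{1,\dots,r\}$: - $\mathrm{bdry}\,C_i(t,k)=\{x\in\mathbb R^n:\psi_i(t,x)=-\alpha_k\}\neq\emptyset$; - $\mathrm{int}\,C_i(t,k)=\{x\in\mathbb R^n:\psi_i(t,x)<-\alpha_k\}\ne\emptyset$; - $C_i(t,k)$ is $\frac{\eta}{4M_\psi}$-prox-regular, $C_i(t,k)=\mathrm{cl}(\mathrm{int}\,C_i(t,k))$, and for all $x\in\mathrm{bdry}\,C_i(t,k)$, $$N_{C_i(t,k)}(x)=N^P_{C_i(t,k)}(x)=N^L_{C_i(t,k)}(x)=\{\lambda\nabla_x\psi_i(t,x):\lambda\ge0\}.$$ (iv) For $t\in[0,T]$, $i\in\{1,\dots,r\}$, $k\in\mathbb N$, let $\pi_k^{i,t}$ be the projection map (nearest-point map) from $\mathrm{bdry}\,C_i(t)$ onto $\mathrm{bdry}\,C_i(t,k)$. Then there exists $k_2\ge k_1$ such that for $k\ge k_2$, $\pi_k^{i,t}$ is bi-Lipschitz uniformly with respect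 to $t$, $k$ and $i$ (i.e. it is a single-valued bijection from $\mathrm{bdry}\,C_i(t)$ onto $\mathrm{bdry}\,C_i(t,k)$, and it and its inverse are Lipschitz with constants independent of $t\in[0,T]$, $k\ge k_2$ and $i$). (v) Assume $n>1$. Then there exists $\beta>0$ such that for every $k\ge k_2$, $t\in[0,T]$ and $i=1,\dots,r$, $\mathrm{bdry}\,C_i(t,k)$ is $\beta$-quasiconvex, in the following precise sense: for every such $k,t,i$ and every $x,y\in\mathrm{bdry}\,C_i(t,k)$ there exists a Lipschitz curve $\Gamma:[0,1]\to\mathrm{bdry}\,C_i(t,k)$ with $$\Gamma(0)=x,\qquad\Gamma(1)=y,\qquad\ell(\Gamma):=\int_0^1\|\dot\Gamma(s)\|\,ds\le\beta\|y-x\|.$$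
   Context: Fix $T>0$ and $n,m,r\in\mathbb N$ (positive), $U\subset\mathbb R^m$ nonempty and compact, $f:\mathbb R^n\times\mathbb R^m\to\mathbb R^n$, functions $\psi_i:[0,T]\times\mathbb R^n\to\mathbb R$ ($i=1,\dots,r$), and put $C_i(t):=\{x\in\mathbb R^n:\psi_i(t,x)\le0\}$, $C(t):=\bigcap_{i=1}^rC_i(t)$. $\|\cdot\|$ is the Euclidean norm, $B(0;\rho)$ the open ball of radius $\rho$ centered at $0$, $d(c,S)$ the distance from $c$ to $S$. Standing hypothesis (H3): $C(t)\ne\emptyset$ for all $t\in[0,T]$; each $\psi_i$ is continuous on $[0,T]\times\mathbb R^n$, and $\psi_i(t,\cdot)$ is $\mathcal C^{1,1}$ (differentiable with locally Lipschitz derivative) for each $t$. For every $i$ and $t$, $\mathrm{bdry}\,C_i(t)$ is connected if $n>1$, and $C_i(t)$ is convex if $n=1$. There are $M_t,M_\psi,R>0$ such that for all $i$ and all $t$, $C_i(t)\subset B(0;R)$, and for all $t,s\in[0,T]$, $x,y\in B(0;2R)$: $|\psi_i(t,x)-\psi_i(s,x)|\le M_t|t-s|$ and $\|\nabla_x\psi_i(t,x)-\nabla_x\psi_i(t,y)\|\le 2M_\psi\|x-y\|$. With $\mathcal I^0_x(t):=\{i:\psi_i(t,x)=0\}$, there is $\eta>0$ such that for every $t\in[0,T]$, every $c\in\mathbb R^n$ with $\mathcal I^0_c(t)\neq\emptyset$, and all $\lambda_i\ge0$ ($i\in\mathcal I^0_c(t)$) with $\sum_i\lambda_i=1$: $\big\|\sum_{i\in\mathcal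 I^0_c(t)}\lambda_i\nabla_x\psi_i(t,c)\big\|>2\eta$. Increasing $M_\psi$ if necessary, $M_\psi\ge\eta/R$. $M>0$ is a constant: it equals $M_0+\frac{M_t}{\eta}$, where $M_0>0$ is such that, on $C_{[0,T]}:=\bigcup_tC(t)$, $f$ is continuous on $C_{[0,T]}\times U$, $\|f\|\le M_0$ on $C_{[0,T]}\times U$, and $x\mapsto f(x,u)$ is $M_0$-Lipschitz on $C_{[0,T]}$ for each $u\in U$. $(\gamma_k)_k$ is a real sequence with $\gamma_k\ge\frac{2Me}{\eta}$ for all $k$ and $\gamma_k\to\infty$. Set $\alpha_k:=\frac1{\gamma_k}\ln\big(\frac{\eta\gamma_k}{2M}\big)$ (so $\alpha_k>0$, $\alpha_k\to0$) and $$C_i(t,k):=\{x\in\mathbb R^n:\psi_i(t,x)\le-\alpha_k\}.$$ $N_S,N_S^P,N_S^L$ denote the Clarke, proximal and Mordukhovich (limiting) normal cones to a closed set $S$. A closed set $S$ is $\rho$-prox-regular if $\langle\zeta,x-s\rangle\le\frac1{2\rho}\|x-s\|^2$ for all $s,x\in S$ and all unit $\zeta\in N_S^P(s)$. A map is bi-Lipschitz if it is a Lipschitz bijection with Lipschitz inverse. *)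

(* Defs.v *)
From HB Require Import structures.
From mathcomp Require Import all_boot all_order all_algebra.
From mathcomp Require Import all_classical all_reals all_analysis.

Set Implicit Arguments.
Unset Strict Implicit.
Unset Printing Implicit Defensive.

Import Order.TTheory GRing.Theory Num.Theory.
Import numFieldNormedType.Exports.

Local Open Scope classical_set_scope.
Local Open Scope ring_scope.

(* The norm [`|_|] that MathComp-Analysis puts on row vectors is the sup norm.
   It is used below only through the topology (and the notion of derivative)
   that it induces; every quantitative bound uses the Euclidean norm [enorm]. *)
Definition dotv (R : realType) (n : nat) (u v : 'rV[R]_n) : R :=
  \sum_(j < n) u 0 j * v 0 j.

Definition enorm (R : realType) (n : nat) (u : 'rV[R]_n) : R :=
  Num.sqrt (dotv u u).

Definition eball (R : realType) (n : nat) (rho : R) : set 'rV[R]_n :=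
  [set x | enorm x < rho].

(* Extended-real valued, so that the distance to the empty set is +oo. *)
Definition edistance (R : realType) (n : nat) (c : 'rV[R]_n)
    (S : set 'rV[R]_n) : \bar R :=
  ereal_inf [set (enorm (c - s))%:E | s in S].

Definition bdry (T : topologicalType) (A : set T) : set T :=
  closure A `\` A°.

Definition grad (R : realType) (n : nat) (g : 'rV[R]_n -> R) (x : 'rV[R]_n) :
    'rV[R]_n :=
  \row_(j < n) 'D_(delta_mx 0 j) (g : 'rV[R]_n -> R^o) x.

Definition elipschitz_on (R : realType) (n p : nat) (L : R)
    (A : set 'rV[R]_n) (g : 'rV[R]_n -> 'rV[R]_p) : Prop :=
  forall x y, A x -> A y -> enorm (g x - g y) <= L * enorm (x - y).

Definition C11 (R : realType) (n : nat) (g : 'rV[R]_n -> R) : Prop :=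
  (forall x, differentiable (g : 'rV[R]_n -> R^o) x) /\
  (forall x : 'rV[R]_n, exists L : R, exists2 V : set 'rV[R]_n,
     nbhs x V & elipschitz_on L V (grad g)).

Section NormalCones.
Variables (R : realType) (n : nat) (S : set 'rV[R]_n).

Definition proximal_normal_cone (s : 'rV[R]_n) : set 'rV[R]_n :=
  [set zeta | S s /\ exists2 sigma : R, 0 <= sigma &
     forall x, S x -> dotv zeta (x - s) <= sigma * enorm (x - s) ^+ 2].

Definition limiting_normal_cone (s : 'rV[R]_n) : set 'rV[R]_n :=
  [set zeta | S s /\ exists (s_ zeta_ : nat -> 'rV[R]_n),
     [/\ forall j, proximal_normal_cone (s_ j) (zeta_ j),
         s_ @ \oo --> s & zeta_ @ \oo --> zeta]].

Definition clarke_tangent_cone (s : 'rV[R]_n) : set 'rV[R]_n :=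
  [set v | S s /\ forall (s_ : nat -> 'rV[R]_n) (tau : nat -> R),
     (forall j, S (s_ j)) -> s_ @ \oo --> s ->
     (forall j, 0 < tau j) -> tau @ \oo --> (0 : R) ->
     exists2 v_ : nat -> 'rV[R]_n, v_ @ \oo --> v &
       forall j, S (s_ j + tau j *: v_ j)].

Definition clarke_normal_cone (s : 'rV[R]_n) : set 'rV[R]_n :=
  [set zeta | S s /\
     forall v, clarke_tangent_cone s v -> dotv zeta v <= 0].

Definition prox_regular (rho : R) : Prop :=
  closed S /\
  forall s x zeta : 'rV[R]_n, S s -> S x ->
    proximal_normal_cone s zeta -> enorm zeta = 1 ->
    dotv zeta (x - s) <= (2 * rho)^-1 * enorm (x - s) ^+ 2.

Definition nearest_points (c : 'rV[R]_n) : set 'rV[R]_n :=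
  [set s | S s /\ forall s', S s' -> enorm (c - s) <= enorm (c - s')].

End NormalCones.

Section SweepingSets.
Variables (R : realType) (n r : nat) (psi : 'I_r -> R -> 'rV[R]_n -> R).

Definition Ci (i : 'I_r) (t : R) : set 'rV[R]_n := [set x | psi i t x <= 0].

Definition Call (t : R) : set 'rV[R]_n := \bigcap_(i in [set: 'I_r]) Ci i t.

Definition Cunion (T : R) : set 'rV[R]_n := \bigcup_(t in `[0, T]) Call t.

Definition Cik (alpha : nat -> R) (i : 'I_r) (t : R) (k : nat) :
    set 'rV[R]_n :=
  [set x | psi i t x <= - alpha k].

End SweepingSets.

Definition alpha_of (R : realType) (eta M : R) (gamma : nat -> R) (k : nat) :
    R :=
  ln (eta * gamma k / (2 * M)) / gamma k.

(* [P] is the nearest-point map from [A] onto [B] (single-valued on [A]) and it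
   is bi-Lipschitz, with constant [L] for [P] and [L'] for its inverse [Q]. *)
Definition bilipschitz_projection (R : realType) (n : nat) (L L' : R)
    (A B : set 'rV[R]_n) : Prop :=
  exists P Q : 'rV[R]_n -> 'rV[R]_n,
    [/\ forall c, A c -> nearest_points B c = [set P c],
        set_bij A B P, elipschitz_on L A P,
        forall c, A c -> Q (P c) = c & elipschitz_on L' B Q].

(* Curves are total functions on [R] of which only the values on [0, 1] matter.
   A Lipschitz curve is differentiable almost everywhere, so the junk value of
   [derive1] at points of non-differentiability does not affect the length. *)
Definition curve_length (R : realType) (n : nat) (G : R -> 'rV[R]_n) : \bar R :=
  (\int[lebesgue_measure]_(s in `[0%R, 1%R]) (enorm (derive1 G s))%:E)%E.

Definition quasiconvex (R : realType) (n : nat) (beta : R)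
    (S : set 'rV[R]_n) : Prop :=
  forall x y, S x -> S y -> exists G : R -> 'rV[R]_n,
    [/\ exists L : R, forall s t : R, s \in `[0, 1] -> t \in `[0, 1] ->
          enorm (G s - G t) <= L * `|s - t|,
        forall s : R, s \in `[0, 1] -> S (G s),
        G 0 = x, G 1 = y &
        (curve_length G <= (beta * enorm (y - x))%:E)%E].

(* Main.v *)
(* Fix t and i, and write g for psi_i(t, .).  The gradient of g is Lipschitz on
   B(0; 2 rad), so the mean value theorem gives the first-order estimate
   |g y - g x - <grad g x, y - x>| <= L |y - x|^2 with L = 2 Mpsi; everything
   about a single g comes from it.  By compactness of [0, T] x B(0; rad) the
   bound |grad g| > 2 eta persists on -eps <= g <= 0 with eps independent of t
   and i, which makes all constants below uniform.

   Normal cones of {g <= -a}: a proximal or Clarke normal at x is nonpositive on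
   every w with <grad g x, w> < 0, hence is a nonnegative multiple of grad g x;
   limits of proximal normals are proximal because the
   first-order estimate makes the proximal inequality uniform.

   Projection: the nearest point p to c in {g = -a} satisfies
   c = p + lambda grad g p with 0 <= lambda <= 1 / (3 L).  Conversely, for such
   a lambda, p is the unique nearest point and depends on c in a 3-Lipschitz
   way, while lambda |-> g (p + lambda grad g p) increases fast enough for
   lambda, hence c, to be a Lipschitz function of p.

   Quasiconvexity: near x, {g = 0} is a Lipschitz graph over a hyperplane
   orthogonal to grad g x, so nearby points are joined by projecting the segment
   onto the graph.  As {g = 0} is connected, any two of its points are joined by
   a chain of such steps through the cells of a fixed finite grid, visiting each
   cell at most once, and the projection carries the arcs over to {g = -a}. *)

Require Import Defs.
From HB Require Import structures.
From mathcomp Require Import all_boot all_order all_algebra.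
From mathcomp Require Import all_classical all_reals all_analysis.
From mathcomp Require Import ring lra.
Import Order.TTheory GRing.Theory Num.Theory.
Import numFieldNormedType.Exports.
Local Open Scope classical_set_scope.
Local Open Scope ring_scope.

Set Implicit Arguments.
Unset Strict Implicit.
Unset Printing Implicit Defensive.

(** * Euclidean geometry *)

Section Euclidean.
Variables (R : realType) (n : nat).
Implicit Types (u v w x y : 'rV[R]_n) (a e : R).

Lemma dotvC u v : dotv u v = dotv v u.
Proof. by apply: eq_bigr => j _; rewrite mulrC. Qed.

Lemma dotvDl u v w : dotv (u + v) w = dotv u w + dotv v w.
Proof. by rewrite -big_split; apply: eq_bigr => j _; rewrite mxE mulrDl. Qed.

Lemma dotvZl a u v : dotv (a *: u) v = a * dotv u v.
Proof. by rewrite mulr_sumr; apply: eq_bigr => j _; rewrite mxE mulrA. Qed.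

Lemma dotvDr u v w : dotv u (v + w) = dotv u v + dotv u w.
Proof. by rewrite dotvC dotvDl !(dotvC _ u). Qed.

Lemma dotvZr a u v : dotv u (a *: v) = a * dotv u v.
Proof. by rewrite dotvC dotvZl dotvC. Qed.

Lemma dotvNl u v : dotv (- u) v = - dotv u v.
Proof. by rewrite -scaleN1r dotvZl mulN1r. Qed.

Lemma dotvNr u v : dotv u (- v) = - dotv u v.
Proof. by rewrite dotvC dotvNl dotvC. Qed.

Definition dotvE := (dotvDl, dotvDr, dotvNl, dotvNr, dotvZl, dotvZr).

Lemma dotv0l u : dotv 0 u = 0.
Proof. by rewrite -(scale0r 0) dotvZl mul0r. Qed.

Lemma dotv0r u : dotv u 0 = 0.
Proof. by rewrite dotvC dotv0l. Qed.

Lemma dotv_ge0 u : 0 <= dotv u u.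
Proof. by apply: sumr_ge0 => j _; rewrite -expr2 sqr_ge0. Qed.

Lemma enorm_ge0 u : 0 <= enorm u.
Proof. exact: sqrtr_ge0. Qed.

Lemma enorm_sqr u : enorm u ^+ 2 = dotv u u.
Proof. by rewrite sqr_sqrtr // dotv_ge0. Qed.

Lemma coord_le_enorm u j : `|u 0 j| <= enorm u.
Proof.
rewrite -sqrtr_sqr ler_wsqrtr // /dotv (bigD1 j) //= -expr2 lerDl.
by apply: sumr_ge0 => i _; rewrite -expr2 sqr_ge0.
Qed.

Lemma enorm0 : enorm (0 : 'rV[R]_n) = 0.
Proof. by rewrite /enorm dotv0l sqrtr0. Qed.

Lemma enorm_eq0 u : enorm u = 0 -> u = 0.
Proof.
move=> u0; apply/rowP => j; rewrite mxE; apply/eqP.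
by rewrite -normr_le0 -u0 coord_le_enorm.
Qed.

Lemma enormZ a u : enorm (a *: u) = `|a| * enorm u.
Proof.
by rewrite /enorm dotvZl dotvZr mulrA -expr2 sqrtrM ?sqr_ge0 // sqrtr_sqr.
Qed.

Lemma enormN u : enorm (- u) = enorm u.
Proof. by rewrite /enorm dotvNl dotvNr opprK. Qed.

Lemma enormBC u v : enorm (u - v) = enorm (v - u).
Proof. by rewrite -enormN opprB. Qed.

(** Cauchy-Schwarz, from the nonnegativity of the square of [enorm v *: u - enorm u *: v]. Zero
    vectors are treated apart because the last step divides by [enorm u * enorm v]. *)
Lemma dotv_le u v : dotv u v <= enorm u * enorm v.
Proof.
have [u0|u_neq0] := eqVneq (enorm u) 0.
  by rewrite (enorm_eq0 u0) dotv0l enorm0 mul0r.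
have [v0|v_neq0] := eqVneq (enorm v) 0.
  by rewrite (enorm_eq0 v0) dotv0r enorm0 mulr0.
have uv_gt0 : 0 < enorm u * enorm v.
  by apply: mulr_gt0; rewrite lt_neqAle enorm_ge0 andbT eq_sym.
have := dotv_ge0 (enorm v *: u - enorm u *: v).
rewrite !dotvE (dotvC v u) -!enorm_sqr.
move: uv_gt0; set a := enorm u; set b := enorm v => ab_gt0 H.
have {}H : 0 <= 2 * (a * b) * (a * b - dotv u v) by apply: le_trans H _; lra.
by move: H; rewrite pmulr_rge0 ?subr_ge0 // mulr_gt0.
Qed.

Lemma dotv_abs_le u v : `|dotv u v| <= enorm u * enorm v.
Proof. by rewrite ler_norml dotv_le lerNl -dotvNl -(enormN u) dotv_le. Qed.

Lemma enorm_triangle u v : enorm (u + v) <= enorm u + enorm v.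
Proof.
rewrite -(@ler_pXn2r _ 2) ?nnegrE ?addr_ge0 ?enorm_ge0 //.
rewrite enorm_sqr !dotvE (dotvC v u) -!enorm_sqr.
have := dotv_le u v; lra.
Qed.

Lemma enormB_triangle w u v : enorm (u - v) <= enorm (u - w) + enorm (w - v).
Proof. by rewrite -{1}(subrK w u) -addrA enorm_triangle. Qed.

Lemma enorm_sub_sqr u v :
  enorm (u - v) ^+ 2 = enorm u ^+ 2 - 2 * dotv u v + enorm v ^+ 2.
Proof. by rewrite !enorm_sqr !dotvE (dotvC v u); ring. Qed.

Lemma norm_le_enorm u : `|u| <= enorm u.
Proof.
rewrite [leLHS]/Num.norm /= mx_normrE.
apply: bigmax_le => [|[i j] _ /=]; first exact: enorm_ge0.
by rewrite (ord1 i) coord_le_enorm.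
Qed.

Lemma coord_le_norm u j : `|u 0 j| <= `|u|.
Proof.
rewrite [leRHS]/Num.norm /= mx_normrE.
by apply/bigmax_geP; right; exists (0, j).
Qed.

Lemma enorm_le_coord u a : (forall j, `|u 0 j| <= a) -> enorm u <= n%:R * a.
Proof.
move=> ua; have [a0|a0] := leP 0 a; last first.
  case: n u ua => [|p] u ua; first by rewrite /enorm /dotv big_ord0 sqrtr0 mul0r.
  by have := lt_le_trans a0 (le_trans (normr_ge0 _) (ua ord0)); rewrite ltxx.
rewrite -(@ler_pXn2r _ 2) ?nnegrE ?enorm_ge0 ?mulr_ge0 //.
rewrite enorm_sqr exprMn /dotv.
apply: (@le_trans _ _ (\sum_(j < n) a ^+ 2)).
  apply: ler_sum => j _; rewrite -expr2 -real_normK ?num_real //.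
  by rewrite lerXn2r ?nnegrE.
rewrite sumr_const card_ord -[leLHS]mulr_natl; apply: ler_wpM2r (sqr_ge0 _) _ _ _.
by rewrite -natrX ler_nat; case: n => // p; rewrite leq_pmulr.
Qed.

Lemma enorm_le_norm u : enorm u <= n%:R * `|u|.
Proof. by apply: enorm_le_coord => j; exact: coord_le_norm. Qed.

(** Bridge between the sup-norm topology and Euclidean balls: the two norms differ by a factor of at
    most [n]. *)
Lemma nbhs_enormP x (A : set 'rV[R]_n) :
  nbhs x A <-> exists2 e, 0 < e & forall y, enorm (y - x) < e -> A y.
Proof.
split=> [/nbhs_normP[e /= e0 eA]|[e e0 eA]].
  exists e => // y yx; apply: eA => /=; rewrite distrC.
  exact: le_lt_trans (norm_le_enorm _) yx.
(* The denominator [n.+1] stays positive for [n = 0]. *)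
apply/(@nbhs_normP R 'rV[R]_n x A); exists (e / n.+1%:R) => /=; first by rewrite divr_gt0.
move=> y /= yx; apply: eA; rewrite enormBC.
apply: le_lt_trans (enorm_le_norm _) _.
rewrite ltr_pdivlMr // mulrC in yx; apply: le_lt_trans yx.
by rewrite ler_wpM2r // ler_nat.
Qed.

Lemma continuous_enormP (f : 'rV[R]_n -> R) :
  (forall x e, 0 < e -> exists2 d, 0 < d &
    forall y, enorm (y - x) < d -> `|f y - f x| < e) ->
  continuous f.
Proof.
move=> fP x A /nbhs_normP[e /= e0 eA]; have [d d0 dP] := fP x e e0.
by apply/nbhs_enormP; exists d => // y /dP yx; apply: eA => /=; rewrite distrC.
Qed.

Lemma enorm_dist u v : `|enorm u - enorm v| <= enorm (u - v).
Proof.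
have := enorm_triangle (u - v) v; have := enorm_triangle (v - u) u.
rewrite !subrK (enormBC v) => h1 h2; rewrite ler_norml; apply/andP; split; lra.
Qed.

Lemma enorm_continuous : continuous (@enorm R n).
Proof.
apply: continuous_enormP => x e e0; exists e => // y yx.
exact: le_lt_trans (enorm_dist _ _) yx.
Qed.

Lemma enorm_sub_continuous c : continuous (fun x : 'rV[R]_n => enorm (x - c)).
Proof.
apply: continuous_enormP => x e e0; exists e => // y yx.
by apply: le_lt_trans (enorm_dist _ _) _; rewrite opprB addrA subrK.
Qed.

Lemma closed_enorm_le c a : closed [set x : 'rV[R]_n | enorm (x - c) <= a].
Proof.
apply: (@closed_comp _ _ (fun x : 'rV[R]_n => enorm (x - c)) [set z | z <= a]).
  by move=> x _; exact: enorm_sub_continuous.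
exact: closed_le.
Qed.

Lemma closed_eball_compact (A : set 'rV[R]_n) a :
  closed A -> A `<=` eball a -> compact A.
Proof.
move=> Acl Aa; apply: bounded_closed_compact => //.
exists a; split; first exact: num_real.
move=> b ab x /Aa /ltW xa; apply: le_trans (norm_le_enorm _) _.
exact: le_trans xa (ltW ab).
Qed.

End Euclidean.

(** * The mean value theorem along segments *)

Section MeanValue.
Variables (R : realType) (n : nat) (g : 'rV[R]_n -> R).
Implicit Types (x y v w : 'rV[R]_n) (s e : R).
Hypothesis g_diff : forall x, differentiable (g : 'rV[R]_n -> R^o) x.

Lemma derive_grad x v : 'D_v (g : 'rV[R]_n -> R^o) x = dotv (grad g x) v.
Proof.
rewrite deriveE // {1}(row_sum_delta v) linear_sum /dotv.
apply: eq_bigr => j _; rewrite linearZ /= /grad mxE deriveE //.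
by rewrite mulrC.
Qed.

Lemma is_derive_line x v s :
  is_derive s 1 (fun t => g (x + t *: v) : R^o) (dotv (grad g (x + s *: v)) v).
Proof.
have eqf : (fun h : R => h^-1 *: ((g (x + (h *: (1 : R) + s) *: v) : R^o)
              - g (x + s *: v))) =
    (fun h => h^-1 *: ((g (h *: v + (x + s *: v)) : R^o) - g (x + s *: v))).
  apply/funext => h; congr (_ *: (g _ - _)).
  by rewrite scalerDl [_ *: 1]mulr1 addrCA.
split.
  rewrite /derivable eqf.
  exact: (@diff_derivable _ _ _ (g : 'rV[R]_n -> R^o) (x + s *: v) v).
by rewrite -derive_grad /derive eqf.
Qed.

Lemma continuous_diff : continuous g.
Proof. by move=> x; apply: differentiable_continuous; exact: g_diff. Qed.

Lemma continuous_line x v : continuous (fun t : R => g (x + t *: v)).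
Proof.
move=> s; apply: (@differentiable_continuous R R^o R^o).
apply/derivable1_diffP; exact: (@ex_derive _ _ _ _ _ _ _ (is_derive_line x v s)).
Qed.

Lemma mean_value x y : exists2 s, 0 < s < 1 &
  g y - g x = dotv (grad g (x + s *: (y - x))) (y - x).
Proof.
have [] := @MVT R (fun t => g (x + t *: (y - x)))
   (fun t => dotv (grad g (x + t *: (y - x))) (y - x)) 0 1 ltr01.
- by move=> s _; exact: is_derive_line.
- by apply: (@continuous_subspaceT R R); exact: continuous_line.
move=> s; rewrite in_itv /= => s01; rewrite scale0r addr0 scale1r (addrC x) subrK subr0 mulr1.
by move=> eq_s; exists s.
Qed.

(** The mean value point lies in the same ball by convexity, and its gradient differs from
    [grad g x] by at most [L * enorm (y - x)]. Hence the constant [L] instead of the sharp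
    [L / 2]. *)
Lemma first_order (rad L : R) x y : 0 <= L ->
  elipschitz_on L (eball rad) (grad g) -> enorm x < rad -> enorm y < rad ->
  `|g y - g x - dotv (grad g x) (y - x)| <= L * enorm (y - x) ^+ 2.
Proof.
move=> L0 g_lip xr yr; have [s /andP[s0 s1] ->] := mean_value x y.
set z := x + _; have zx : enorm (z - x) <= enorm (y - x).
  rewrite /z addrAC subrr add0r enormZ gtr0_norm //.
  by rewrite ler_piMl ?enorm_ge0 // ltW.
have zr : enorm z < rad.
  have -> : z = (1 - s) *: x + s *: y.
    by rewrite /z scalerBr scalerBl scale1r addrA addrAC.
  apply: le_lt_trans (enorm_triangle _ _) _; rewrite !enormZ !gtr0_norm ?subr_gt0 //.
  nra.
rewrite -dotvNl -dotvDl; apply: le_trans (dotv_abs_le _ _) _.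
rewrite expr2 mulrA; apply: ler_wpM2r (enorm_ge0 _) _ _ _.
by apply: le_trans (g_lip _ _ zr xr) _; rewrite ler_wpM2l.
Qed.

Lemma ivt_line x v a b : 0 <= a -> g x <= b -> b <= g (x + a *: v) ->
  exists2 s, 0 <= s <= a & g (x + s *: v) = b.
Proof.
move=> a0 gx gy.
have [] := @IVT R (fun t => g (x + t *: v)) 0 a b a0.
- by apply: (@continuous_subspaceT R R); exact: continuous_line.
- rewrite scale0r addr0; apply/andP; split.
    by rewrite ge_min gx.
  by rewrite le_max gy orbT.
by move=> s; rewrite in_itv /= => s0 <-; exists s.
Qed.

End MeanValue.

(** * Sublevel sets with nondegenerate boundary *)

(** Farkas' lemma for one open half-space. Write [z = u + c *: p] with [u] orthogonal to [p]: if [u]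
    were nonzero, [u - d *: p] with small [d > 0] would lie in the half-space and have a positive
    product with [z]. *)
Lemma polar_halfspace (R : realType) (n : nat) (p z : 'rV[R]_n) :
  p != 0 -> (forall w, dotv p w < 0 -> dotv z w <= 0) ->
  exists2 lambda : R, 0 <= lambda & z = lambda *: p.
Proof.
move=> p_neq0 polar.
have pp_gt0 : 0 < dotv p p.
  rewrite lt_neqAle dotv_ge0 andbT -enorm_sqr eq_sym sqrf_eq0.
  by apply: contra p_neq0 => /eqP /enorm_eq0 ->.
have zp_ge0 : 0 <= dotv z p.
  rewrite -oppr_le0 -dotvNr; apply: polar.
  by rewrite dotvNr oppr_lt0.
exists (dotv z p / dotv p p); first by rewrite divr_ge0 // ltW.
set c := dotv z p / dotv p p; pose u := z - c *: p.
have pu : dotv p u = 0.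
  by rewrite !dotvE /c (dotvC p z) divfK ?subrr // gt_eqF.
have zE : z = u + c *: p by rewrite subrK.
clearbody u; have zu : dotv z u = enorm u ^+ 2.
  by rewrite enorm_sqr zE dotvDl dotvZl pu mulr0 addr0.
suff u0 : u = 0 by rewrite zE u0 add0r.
apply: enorm_eq0; apply/eqP; rewrite -sqrf_eq0 eq_le sqr_ge0 andbT -zu.
rewrite leNgt; apply/negP => zu_gt0.
(* Small enough that [d * dotv z p < dotv z u]; the added 1 covers [dotv z p = 0]. *)
pose d := dotv z u / (2 * (dotv z p + 1)).
have zp1 : 0 < 2 * (dotv z p + 1) by rewrite mulr_gt0 // ltr_wpDl.
have d_gt0 : 0 < d by rewrite divr_gt0.
have := polar (u - d *: p); rewrite !dotvE pu add0r oppr_lt0 mulr_gt0 // => /(_ isT).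
apply/negP; rewrite -ltNge subr_gt0.
have : d * (2 * (dotv z p + 1)) = dotv z u by rewrite divfK // gt_eqF.
nra.
Qed.

(* [L] plays the role of [2 * Mpsi]; [rs_grad] is the nondegeneracy on the level
   0, extended to a band of levels of width [eps]. *)
Record regular_sublevel (R : realType) (n : nat) (g : 'rV[R]_n -> R)
    (rad L eta eps : R) : Prop := RegularSublevel {
  rs_rad : 0 < rad;
  rs_L : 0 < L;
  rs_eta : 0 < eta;
  rs_eps : 0 < eps;
  rs_diff : forall x, differentiable (g : 'rV[R]_n -> R^o) x;
  rs_lip : elipschitz_on L (eball (2 * rad)) (grad g);
  rs_in : forall x, g x <= 0 -> enorm x < rad;
  rs_ne : exists x, g x <= 0;
  rs_grad : forall x, - eps <= g x -> g x <= 0 -> 2 * eta < enorm (grad g x) }.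

Section RegularSublevel.
Variables (R : realType) (n : nat) (g : 'rV[R]_n -> R) (rad L eta eps : R).
Hypothesis H : regular_sublevel g rad L eta eps.
Implicit Types (x y z v w : 'rV[R]_n) (a s : R).

Let rad0 : 0 < rad. Proof. exact: rs_rad H. Qed.
Let L0 : 0 < L. Proof. exact: rs_L H. Qed.
Let eta0 : 0 < eta. Proof. exact: rs_eta H. Qed.
Let g_diff := rs_diff H.
Let g_lip := rs_lip H.
Let g_in := rs_in H.

Lemma first_order_up x w : enorm x < 2 * rad -> enorm (x + w) < 2 * rad ->
  g (x + w) <= g x + dotv (grad g x) w + L * enorm w ^+ 2.
Proof.
move=> xr xwr; have := first_order g_diff (ltW L0) g_lip xr xwr.
rewrite (addrC x) addrK ler_norml => /andP[_]; lra.
Qed.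

Lemma first_order_low x w : enorm x < 2 * rad -> enorm (x + w) < 2 * rad ->
  g x + dotv (grad g x) w - L * enorm w ^+ 2 <= g (x + w).
Proof.
move=> xr xwr; have := first_order g_diff (ltW L0) g_lip xr xwr.
rewrite (addrC x) addrK ler_norml => /andP[]; lra.
Qed.

Lemma enorm_add_lt x w : enorm x < rad -> enorm w <= rad -> enorm (x + w) < 2 * rad.
Proof. by move=> xr wr; have := enorm_triangle x w; lra. Qed.

Lemma eball_rad x : enorm x < rad -> enorm x < 2 * rad.
Proof. by move: rad0; lra. Qed.

(* Uniform in the base point [z], as the Clarke tangent cone requires. *)
Lemma strict_descent x w : enorm x < rad -> dotv (grad g x) w < 0 ->
  exists2 d : R, 0 < d & forall z s, enorm (z - x) < d -> 0 < s -> s < d ->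
    g (z + s *: w) < g z.
Proof.
move=> xr; set c := - dotv (grad g x) w => c0; pose W := enorm w + 1.
have {}c0 : 0 < c by rewrite oppr_gt0.
have W1 : 1 <= W by rewrite lerDr enorm_ge0.
have wW : enorm w <= W by rewrite lerDl.
have W0 : 0 < W by lra.
(* The first entry keeps [z] and [z + s *: w] in the ball of radius [2 * rad]. The second bounds the
   drift of the gradient from [x] to [z] and the second-order error, together, by [s * c / 2]. *)
pose d := Num.min (rad / (2 * W)) (c / (4 * L * W ^+ 2)).
have d0 : 0 < d by rewrite lt_min !divr_gt0 ?mulr_gt0 ?exprn_gt0.
have dr : d * (2 * W) <= rad.
  by rewrite -ler_pdivlMr ?mulr_gt0 // ge_min lexx.
have dc : d * (4 * L * W ^+ 2) <= c.
  by rewrite -ler_pdivlMr ?mulr_gt0 ?exprn_gt0 // ge_min lexx orbT.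
exists d => // z s zx s0 sd.
have sw : enorm (s *: w) <= s * W.
  by rewrite enormZ gtr0_norm // ler_pM2l.
have sW : s * W < d * W by rewrite ltr_pM2r.
have dW : d <= d * W by rewrite ler_pMr.
have zr : enorm z < rad + d.
  by have := enorm_triangle (z - x) x; rewrite subrK; lra.
have z2 : enorm z < 2 * rad by lra.
have zsw : enorm (z + s *: w) < 2 * rad.
  by have := enorm_triangle z (s *: w); lra.
apply: le_lt_trans (first_order_up z2 zsw) _.
rewrite dotvZr enormZ gtr0_norm //.
have gz : dotv (grad g z) w <= - c + L * d * W.
  have -> : dotv (grad g z) w = - c + dotv (grad g z - grad g x) w.
    by rewrite /c dotvDl dotvNl opprK addrC subrK.
  rewrite lerD2l; apply: le_trans (dotv_le _ _) _.
  have h1 := g_lip z2 (eball_rad xr).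
  apply: ler_pM => //; rewrite ?enorm_ge0 //.
  by apply: le_trans h1 _; rewrite ler_pM2l // ltW.
have h2 : L * (s * enorm w) ^+ 2 <= s * (L * d * W ^+ 2).
  rewrite exprMn.
  have -> : L * (s ^+ 2 * enorm w ^+ 2) = s * (L * (s * enorm w ^+ 2)) by ring.
  rewrite ler_pM2l // -mulrA ler_pM2l //.
  apply: (ler_pM (ltW s0) (sqr_ge0 _) (ltW sd)).
  by rewrite lerXn2r ?nnegrE ?enorm_ge0 // ltW.
have h3 : W <= W ^+ 2 by rewrite expr2 ler_peMr // ltW.
have h4 : L * d * W <= L * d * W ^+ 2 by rewrite ler_pM2l // mulr_gt0.
have h5 : s * dotv (grad g z) w + s * (L * d * W ^+ 2) < 0.
  rewrite -mulrDr pmulr_rlt0 //; lra.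
lra.
Qed.

Lemma continuous_regular : continuous g.
Proof. exact: continuous_diff g_diff. Qed.

Lemma closed_sublevel a : closed [set x | g x <= a].
Proof.
apply: (@closed_comp _ _ g [set z | z <= a]); last exact: closed_le.
by move=> x _; exact: continuous_regular.
Qed.

Lemma open_sublevel a : open [set x | g x < a].
Proof.
apply: (@open_comp _ _ g [set z | z < a]); last exact: open_lt.
by move=> x _; exact: continuous_regular.
Qed.

Lemma compact_sublevel a : a <= 0 -> compact [set x | g x <= a].
Proof.
move=> a0; apply: (@closed_eball_compact _ _ _ rad); first exact: closed_sublevel.
by move=> x /= gx; apply: g_in; exact: le_trans gx a0.
Qed.

Lemma grad0_of_minimum x : enorm x < rad -> (forall y, g x <= g y) -> grad g x = 0.
Proof.
move=> xr xmin; apply/eqP/negPn/negP => g0.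
have gN : dotv (grad g x) (- grad g x) < 0.
  rewrite dotvNr oppr_lt0 lt_neqAle dotv_ge0 andbT -enorm_sqr eq_sym sqrf_eq0.
  by apply: contra g0 => /eqP /enorm_eq0 ->.
have [d d0 dP] := strict_descent xr gN.
have := dP x (d / 2); rewrite subrr enorm0 d0 divr_gt0 // gtr_pMr //.
rewrite invf_lt1 // ltr1n => /(_ isT isT isT).
by rewrite ltNge xmin.
Qed.

(** A minimizer over the compact sublevel set is a global one, hence critical, so [rs_grad] places
    it strictly below the band. Its zero gradient yields a bound on all gradients, and its low value
    makes interiors and level sets nonempty. *)
Lemma minimizer : exists x0, [/\ g x0 < - eps, enorm x0 < rad & grad g x0 = 0].
Proof.
have [x1 gx1] := rs_ne H.
have [||x0 /set_mem x0A x0min] := @EVT_min_rV R n g [set x | g x <= 0] _ (compact_sublevel (lexx 0)).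
- by exists x1.
- by apply: continuous_subspaceT; exact: continuous_regular.
have x0r := g_in x0A.
have g0 : grad g x0 = 0.
  apply: grad0_of_minimum => // y; have [yA|yA] := leP (g y) 0.
    by apply: x0min; rewrite inE.
  by apply: ltW; exact: le_lt_trans x0A yA.
exists x0; split => //; rewrite ltNge; apply/negP => e0.
by have := rs_grad H e0 x0A; rewrite g0 enorm0; move: eta0; lra.
Qed.

(** A point of the ball of radius [2 * rad] is within [3 * rad] of the critical point, and the
    gradient is [L]-Lipschitz. *)
Definition grad_bound := 3 * rad * L.

Lemma grad_bound_gt0 : 0 < grad_bound.
Proof. by rewrite /grad_bound !mulr_gt0. Qed.

Lemma grad_le x : enorm x < 2 * rad -> enorm (grad g x) <= grad_bound.
Proof.
move=> xr; have [x0 [_ x0r g0]] := minimizer.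
have := g_lip xr (eball_rad x0r); rewrite g0 subr0 => /le_trans; apply.
rewrite mulrC /grad_bound ler_pM2r //.
have := enorm_triangle x (- x0); rewrite enormN; lra.
Qed.

Lemma sublevel_lipschitz x y : enorm x < 2 * rad -> enorm y < 2 * rad ->
  `|g y - g x| <= grad_bound * enorm (y - x).
Proof.
move=> xr yr; have [s /andP[s0 s1] ->] := mean_value g_diff x y.
apply: le_trans (dotv_abs_le _ _) _; apply: ler_wpM2r (enorm_ge0 _) _ _ _.
apply: grad_le.
have -> : x + s *: (y - x) = (1 - s) *: x + s *: y.
  by rewrite scalerBr scalerBl scale1r addrA addrAC.
apply: le_lt_trans (enorm_triangle _ _) _; rewrite !enormZ !gtr0_norm ?subr_gt0 //.
nra.
Qed.

End RegularSublevel.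

(** * Level sets and their normal cones *)

Section NormalConeFacts.
Variables (R : realType) (n : nat).
Implicit Types (S : set 'rV[R]_n) (x s v w : 'rV[R]_n).

Lemma cvg_dotv (u_ v_ : nat -> 'rV[R]_n) u v :
  u_ @ \oo --> u -> v_ @ \oo --> v ->
  (fun j => dotv (u_ j) (v_ j)) @ \oo --> dotv u v.
Proof.
move=> cu cv; rewrite /dotv; apply: cvg_big => [|j _]; first exact: add_continuous.
apply: cvgM.
  by apply: (cvg_comp u_ (fun M : 'rV[R]_n => M 0 j) cu); exact: coord_continuous.
by apply: (cvg_comp v_ (fun M : 'rV[R]_n => M 0 j) cv); exact: coord_continuous.
Qed.

(** Along a feasible direction the proximal inequality reads [t * dotv z w <= sigma * t ^+ 2 * enorm
    w ^+ 2]; dividing by [t] and taking [t] small excludes a positive product. *)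
Lemma proximal_feasible_direction S s z w (d : R) : proximal_normal_cone S s z ->
  0 < d -> (forall t, 0 < t -> t < d -> S (s + t *: w)) -> dotv z w <= 0.
Proof.
move=> [Ss [sigma sigma0 zP]] d0 dS; rewrite leNgt; apply/negP => zw.
pose K := sigma * enorm w ^+ 2 + 1.
have K0 : 0 < K by rewrite ltr_wpDl // mulr_ge0 // sqr_ge0.
pose t := Num.min (d / 2) (dotv z w / K).
have t0 : 0 < t by rewrite lt_min !divr_gt0.
have td : t < d by rewrite gt_min ltr_pdivrMr // mulr_natr mulr2n ltrDl d0.
have tK : t * K <= dotv z w by rewrite -ler_pdivlMr // ge_min lexx orbT.
have := zP _ (dS t t0 td).
rewrite (addrC s) addrK dotvZr enormZ gtr0_norm // exprMn.
have -> : sigma * (t ^+ 2 * enorm w ^+ 2) = t * (t * K - t) by rewrite /K; ring.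
rewrite ler_pM2l //; lra.
Qed.

Lemma proximal_sub_limiting S s :
  proximal_normal_cone S s `<=` limiting_normal_cone S s.
Proof.
move=> z zP; split; first by case: zP.
by exists (fun=> s), (fun=> z); split => //; exact: cvg_cst.
Qed.

(** Apply the definition of a tangent vector to the constant base sequence and harmonic steps: the
    proximal inequality, divided by the step, has right-hand side tending to 0. *)
Lemma proximal_sub_clarke S s :
  proximal_normal_cone S s `<=` clarke_normal_cone S s.
Proof.
move=> z [Ss [sigma sigma0 zP]]; split=> // v [_ vT].
have tau0 (j : nat) : 0 < harmonic j :> R by rewrite invr_gt0.
have [v_ cv vS] := vT (fun=> s) harmonic (fun=> Ss) (cvg_cst _) tau0 (@cvg_harmonic R).
have zvj (j : nat) : dotv z (v_ j) <= sigma * (harmonic j * dotv (v_ j) (v_ j)).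
  have := zP _ (vS j).
  rewrite (addrC s) addrK dotvZr enormZ gtr0_norm // exprMn enorm_sqr.
  rewrite expr2 -!mulrA mulrCA ler_pM2l //.
have lim0 : (fun j : nat => sigma * (harmonic j * dotv (v_ j) (v_ j))) @ \oo --> (0 : R).
  have <- : sigma * (0 * dotv v v) = 0 by rewrite mul0r mulr0.
  apply: cvgM; first exact: cvg_cst.
  by apply: cvgM; [exact: cvg_harmonic | exact: cvg_dotv].
apply: ler_cvg_to (cvg_dotv (cvg_cst z) cv) lim0 _.
by apply: nearW => j; exact: zvj.
Qed.

End NormalConeFacts.

(** * Boundary, interior and normal cones for the levels inside the band *)

Section LevelSets.
Variables (R : realType) (n : nat) (g : 'rV[R]_n -> R) (rad L eta eps a : R).
Hypotheses (n_gt0 : (0 < n)%N) (H : regular_sublevel g rad L eta eps).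
Hypotheses (a_ge0 : 0 <= a) (a_le : a <= eps).
Implicit Types (x y z v w p : 'rV[R]_n) (s : R).

Let rad0 : 0 < rad. Proof. exact: rs_rad H. Qed.
Let L0 : 0 < L. Proof. exact: rs_L H. Qed.
Let eta0 : 0 < eta. Proof. exact: rs_eta H. Qed.

Let S := [set x | g x <= - a].

Lemma sublevel_lt_rad x : S x -> enorm x < rad.
Proof. by move=> Sx; apply: rs_in H _ _; apply: le_trans Sx _; rewrite oppr_le0. Qed.

Lemma level_grad x : g x = - a -> 2 * eta < enorm (grad g x).
Proof. by move=> gx; apply: rs_grad H _ _ _; rewrite gx ?lerN2 ?oppr_le0. Qed.

Lemma level_grad_neq0 x : g x = - a -> grad g x != 0.
Proof.
move=> /level_grad gx; apply/eqP => g0; move: gx; rewrite g0 enorm0.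
by move: eta0; lra.
Qed.

Lemma level_dotv_gt0 x : g x = - a -> 0 < dotv (grad g x) (grad g x).
Proof.
move=> gx; rewrite -enorm_sqr exprn_gt0 //.
by apply: lt_trans (level_grad gx); rewrite mulr_gt0.
Qed.

Lemma level_sublevel x : g x = - a -> S x.
Proof. by rewrite /S /= => ->. Qed.

Lemma level_descent x : g x = - a -> exists2 d : R, 0 < d &
  forall s, 0 < s -> s < d ->
    g (x + s *: - grad g x) < - a /\ - a < g (x + s *: grad g x).
Proof.
move=> gx; have xr := sublevel_lt_rad (level_sublevel gx).
have [|d d0 dP] := strict_descent H xr (_ : dotv (grad g x) (- grad g x) < 0).
  by rewrite dotvNr oppr_lt0 level_dotv_gt0.
pose N := enorm (grad g x) + 1.
have N1 : 1 <= N by rewrite lerDr enorm_ge0.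
have NN : enorm (grad g x) <= N by rewrite lerDl.
have N0 : 0 < N by lra.
exists (d / N) => [|s s0 sd]; first by rewrite divr_gt0.
have sNd : s * N < d by rewrite -ltr_pdivlMr.
have sd' : s < d by apply: le_lt_trans sNd; rewrite ler_pMr.
split; first by rewrite -gx dP // subrr enorm0.
(* The upward inequality is the descent from the base point [x + s *: grad g x] back to [x]; this
   uses the uniformity of [strict_descent] in its base point. *)
have := dP (x + s *: grad g x) s; rewrite scalerN addrK gx; apply => //.
rewrite (addrC x) addrK enormZ gtr0_norm //; apply: le_lt_trans sNd.
by rewrite ler_pM2l.
Qed.

Lemma interior_sublevel : S° = [set x | g x < - a].
Proof.
apply/seteqP; split => [x Sx|x gx]; last first.
  apply: (@filterS _ _ _ [set x | g x < - a]).
    by move=> y /= /ltW.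
  by apply: open_nbhs_nbhs; split => //; exact: open_sublevel H _.
have : g x <= - a := interior_subset Sx.
rewrite le_eqVlt => /orP[/eqP gx|//].
have [d d0 dP] := level_descent gx.
have /nbhs_enormP[e e0 eS] := Sx.
pose N := enorm (grad g x) + 1.
have NN : enorm (grad g x) < N by rewrite ltrDl.
have N0 : 0 < N by apply: le_lt_trans NN; exact: enorm_ge0.
pose s := Num.min (d / 2) (e / N).
have s0 : 0 < s by rewrite lt_min !divr_gt0.
have sd : s < d by rewrite gt_min ltr_pdivrMr // mulr_natr mulr2n ltrDl d0.
have sN : s * N <= e by rewrite -ler_pdivlMr // ge_min lexx orbT.
have [_] := dP s s0 sd; rewrite ltNge => /negP[]; apply: eS.
rewrite (addrC x) addrK enormZ gtr0_norm //; apply: lt_le_trans sN.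
by rewrite ltr_pM2l.
Qed.

Lemma bdry_sublevel : bdry S = [set x | g x = - a].
Proof.
rewrite /bdry -(closure_id S).1 ?interior_sublevel; last exact: closed_sublevel H _.
apply/seteqP; split => [x [/= gx /negP]|x /= gx].
  by rewrite -leNgt => xg; apply/eqP; rewrite eq_le gx.
by split; [exact: level_sublevel | rewrite /= gx ltxx].
Qed.

Lemma closure_interior_sublevel : S = closure S°.
Proof.
apply/seteqP; split => [x Sx|]; last first.
  rewrite {2}(closure_id S).1; last exact: closed_sublevel H _.
  by apply: closure_subset; exact: interior_subset.
move: (Sx); rewrite /S /= le_eqVlt => /orP[/eqP gx|gx]; last first.
  by apply: subset_closure; rewrite interior_sublevel.
move=> B /nbhs_enormP[e e0 eB].
have [d d0 dP] := level_descent gx.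
pose N := enorm (grad g x) + 1.
have NN : enorm (grad g x) < N by rewrite ltrDl.
have N0 : 0 < N by apply: le_lt_trans NN; exact: enorm_ge0.
pose s := Num.min (d / 2) (e / N).
have s0 : 0 < s by rewrite lt_min !divr_gt0.
have sd : s < d by rewrite gt_min ltr_pdivrMr // mulr_natr mulr2n ltrDl d0.
have sN : s * N <= e by rewrite -ler_pdivlMr // ge_min lexx orbT.
exists (x + s *: - grad g x); split.
  by rewrite interior_sublevel /=; case: (dP s s0 sd).
apply: eB; rewrite (addrC x) addrK enormZ gtr0_norm // enormN.
by apply: lt_le_trans sN; rewrite ltr_pM2l.
Qed.

Lemma interior_sublevel_neq0 : S° !=set0.
Proof.
have [x0 [gx0 _ _]] := minimizer H; exists x0; rewrite interior_sublevel /=.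
by apply: lt_le_trans gx0 _; rewrite lerN2.
Qed.

(** Intermediate values on a segment from the minimizer along a coordinate axis: after a step
    [2 * rad] it has left the ball that contains the sublevel set. *)
Lemma level_neq0 : [set x | g x = - a] !=set0.
Proof.
have [x0 [gx0 x0r _]] := minimizer H.
pose j0 : 'I_n := Ordinal n_gt0; pose v : 'rV[R]_n := delta_mx 0 j0.
have [|||s _ gs] := @ivt_line _ _ g (rs_diff H) x0 v (2 * rad) (- a).
- by rewrite mulr_ge0 // ltW.
- by apply: ltW; apply: lt_le_trans gx0 _; rewrite lerN2.
- rewrite leNgt; apply/negP => /ltW /sublevel_lt_rad.
  apply/negP; rewrite -leNgt.
  have := coord_le_enorm (x0 + (2 * rad) *: v) j0.
  rewrite !mxE !eqxx mulr1; apply: le_trans.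
  have := coord_le_enorm x0 j0; have := ler_norm (x0 0 j0 + 2 * rad).
  rewrite ler_norml => h /andP[h1 h2]; lra.
by exists (x0 + s *: v).
Qed.

Lemma dotv_level_le p x : g p = - a -> S x ->
  dotv (grad g p) (x - p) <= L * enorm (x - p) ^+ 2.
Proof.
move=> gp Sx; have pS := level_sublevel gp.
have xr := eball_rad H (sublevel_lt_rad Sx); have pr := eball_rad H (sublevel_lt_rad pS).
have := first_order (rs_diff H) (ltW L0) (rs_lip H) pr xr; rewrite ler_norml => /andP[h _].
by move: (Sx); rewrite /S /= -gp; move: h; lra.
Qed.

(** Every direction is feasible at an interior point, in particular [z] itself. *)
Lemma proximal_interior x z : g x < - a -> proximal_normal_cone S x z -> z = 0.
Proof.
move=> gx zP; apply: enorm_eq0; apply/eqP; rewrite -sqrf_eq0 eq_le sqr_ge0 andbT enorm_sqr.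
have xi : S° x by rewrite interior_sublevel.
have /nbhs_enormP[e e0 eS] := xi.
have N0 : 0 < enorm z + 1 by rewrite ltr_wpDl ?enorm_ge0.
apply: (proximal_feasible_direction zP (_ : 0 < e / (enorm z + 1))).
  by rewrite divr_gt0.
move=> t t0; rewrite ltr_pdivlMr // => te; apply: eS.
rewrite (addrC x) addrK enormZ gtr0_norm //; apply: le_lt_trans te.
by rewrite ler_pM2l // lerDl.
Qed.

Definition grad_cone x : set 'rV[R]_n :=
  [set lambda *: grad g x | lambda in [set lambda : R | 0 <= lambda]].

Lemma proximal_sub_grad_cone x : g x = - a ->
  proximal_normal_cone S x `<=` grad_cone x.
Proof.
move=> gx z zP.
have [w gw|lambda l0 ->] := polar_halfspace (z := z) (level_grad_neq0 gx); last by exists lambda.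
have xr := sublevel_lt_rad (level_sublevel gx).
have [d d0 dP] := strict_descent H xr gw.
apply: (proximal_feasible_direction zP d0) => t t0 td.
by rewrite /S /= -gx ltW // dP // subrr enorm0.
Qed.

Lemma grad_cone_sub_proximal x : g x = - a ->
  grad_cone x `<=` proximal_normal_cone S x.
Proof.
move=> gx _ [lambda /= l0 <-]; split; first exact: level_sublevel.
exists (lambda * L) => [|y Sy]; first by rewrite mulr_ge0 // ltW.
by rewrite dotvZl -mulrA ler_wpM2l // dotv_level_le.
Qed.

(** A proximal normal at the level is [lambda *: grad g x], and [lambda <= enorm z / (2 * eta)] by
    nondegeneracy. The constant is independent of [x], which gives prox-regularity and allows
    passing to limits of normals. *)
Lemma proximal_uniform x z y : S x -> proximal_normal_cone S x z -> S y ->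
  dotv z (y - x) <= L / (2 * eta) * enorm z * enorm (y - x) ^+ 2.
Proof.
move=> Sx zP Sy; move: (Sx); rewrite /S /= le_eqVlt => /orP[/eqP gx|gx]; last first.
  by rewrite (proximal_interior gx zP) dotv0l enorm0 mulr0 mul0r.
have [lambda /= l0 <-] := proximal_sub_grad_cone gx zP.
rewrite dotvZl; apply: (@le_trans _ _ (lambda * (L * enorm (y - x) ^+ 2))).
  by rewrite ler_wpM2l // dotv_level_le.
rewrite enormZ ger0_norm // mulrA; apply: ler_wpM2r (sqr_ge0 _) _ _ _.
have -> : L / (2 * eta) * (lambda * enorm (grad g x)) =
  lambda * (L * (enorm (grad g x) / (2 * eta))).
  by field; rewrite gt_eqF.
rewrite ler_wpM2l // ler_pMr // ler_pdivlMr ?mulr_gt0 // mul1r.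
by rewrite ltW // level_grad.
Qed.

(** The uniform inequality would give the radius [eta / L]; half of it is stated, which for
    [L = 2 * Mpsi] is [eta / (4 * Mpsi)]. *)
Lemma prox_regular_sublevel : prox_regular S (eta / (2 * L)).
Proof.
split=> [|s x zeta Ss Sx zP z1]; first exact: closed_sublevel H _.
apply: le_trans (proximal_uniform Ss zP Sx) _; rewrite z1 mulr1.
apply: ler_wpM2r (sqr_ge0 _) _ _ _.
have -> : (2 * (eta / (2 * L)))^-1 = L / (2 * eta) * 2.
  by field; rewrite !gt_eqF.
by rewrite ler_peMr ?ler1n // divr_ge0 ?mulr_ge0 // ltW.
Qed.

Lemma limiting_sub_proximal x : limiting_normal_cone S x `<=` proximal_normal_cone S x.
Proof.
move=> z [Sx [s_ [z_ [zP cs cz]]]]; split=> //.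
exists (L / (2 * eta) * enorm z) => [|y Sy].
  by rewrite !mulr_ge0 ?enorm_ge0 // ?invr_ge0 ?mulr_ge0 // ltW.
have cys : (fun j => y - s_ j) @ \oo --> y - x by apply: cvgB => //; exact: cvg_cst.
have cr : (fun j => L / (2 * eta) * enorm (z_ j) * dotv (y - s_ j) (y - s_ j))
    @ \oo --> L / (2 * eta) * enorm z * dotv (y - x) (y - x).
  apply: cvgM; last exact: cvg_dotv.
  apply: cvgM; first exact: cvg_cst.
  by apply: (cvg_comp z_ (@enorm R n) cz); exact: enorm_continuous.
rewrite enorm_sqr; apply: ler_cvg_to (cvg_dotv cz cys) cr _.
apply: nearW => j; rewrite -enorm_sqr; apply: proximal_uniform => //.
by case: (zP j).
Qed.

(** Every [w] with [dotv (grad g x) w < 0] is a Clarke tangent vector: by the uniform descent,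
    [s_ j + tau j *: w] stays in [S] for large [j], and the remaining indices take the direction 0.
    Then [polar_halfspace] applies. *)
Lemma clarke_sub_grad_cone x : g x = - a -> clarke_normal_cone S x `<=` grad_cone x.
Proof.
move=> gx z [Sx zP].
have [w gw|lambda l0 ->] := polar_halfspace (z := z) (level_grad_neq0 gx); last by exists lambda.
apply: zP; split => // s_ tau Ss cs tau0 ctau.
have [d d0 dP] := strict_descent H (sublevel_lt_rad Sx) gw.
exists (fun j => if `[< S (s_ j + tau j *: w) >] then w else 0); last first.
  by move=> j; case: asboolP => // _; rewrite scaler0 addr0.
apply: cvg_near_cst.
have near_s : \forall j \near \oo, enorm (s_ j - x) < d.
  apply: (cs [set y | enorm (y - x) < d]).
  by apply/nbhs_enormP; exists d.
have near_tau : \forall j \near \oo, tau j < d.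
  have /cvgrPdist_lt/(_ d d0) := ctau; apply: filterS => j.
  by rewrite sub0r normrN gtr0_norm.
apply: filterS2 near_s near_tau => j sj tj.
case: asboolP => // -[]; rewrite /S /=; apply: le_trans (Ss j).
by apply: ltW; exact: dP.
Qed.

Lemma normal_cones_sublevel x : g x = - a ->
  [/\ clarke_normal_cone S x = proximal_normal_cone S x,
      proximal_normal_cone S x = limiting_normal_cone S x &
      limiting_normal_cone S x = grad_cone x].
Proof.
move=> gx; have gp := grad_cone_sub_proximal gx; have pg := proximal_sub_grad_cone gx.
have lp := @limiting_sub_proximal x; have pl := @proximal_sub_limiting _ _ S x.
have pc := @proximal_sub_clarke _ _ S x; have cg := clarke_sub_grad_cone gx.
split; apply/seteqP; split => //.
- exact: subset_trans cg gp.
- exact: subset_trans lp pg.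
- exact: subset_trans gp pl.
Qed.

End LevelSets.

(** * Projection between level sets *)

Section Projection.
Variables (R : realType) (n : nat) (g : 'rV[R]_n -> R) (rad L eta eps a : R).
Hypotheses (H : regular_sublevel g rad L eta eps).
Hypotheses (a_ge0 : 0 <= a) (a_le : a <= eps) (a_small : a * (3 * L) <= 2 * eta ^+ 2).
Implicit Types (x y z v w p c : 'rV[R]_n) (s lambda : R).

Let rad0 : 0 < rad. Proof. exact: rs_rad H. Qed.
Let L0 : 0 < L. Proof. exact: rs_L H. Qed.
Let eta0 : 0 < eta. Proof. exact: rs_eta H. Qed.
Let eta2 : 0 < 2 * eta ^+ 2. Proof. by rewrite mulr_gt0 // exprn_gt0. Qed.

Let S := [set x | g x <= - a].
Let G := grad_bound rad L.

(* The bound on [lambda] keeps [c] within the reach of the sublevel set at [p]. *)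
Definition foot p c lambda :=
  [/\ g p = - a, g c = 0, 0 <= lambda, lambda * (3 * L) <= 1 &
      c = p + lambda *: grad g p].

Lemma level0_grad c : g c = 0 -> 2 * eta < enorm (grad g c).
Proof. by move=> gc; apply: rs_grad H _ _ _; rewrite gc ?oppr_le0 // ltW ?(rs_eps H). Qed.

Lemma level0_lt_rad c : g c = 0 -> enorm c < rad.
Proof. by move=> gc; apply: rs_in H _ _; rewrite gc. Qed.

Lemma small_step x s : enorm x < rad -> 0 <= s -> s * (3 * L) <= 1 ->
  enorm (s *: grad g x) <= rad.
Proof.
move=> xr s0 sL; rewrite enormZ ger0_norm //.
have := grad_le H (eball_rad H xr); rewrite /grad_bound => gG.
apply: le_trans (ler_wpM2l s0 gG) _.
have -> : s * (3 * rad * L) = s * (3 * L) * rad by ring.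
by rewrite ler_piMl // ltW.
Qed.

(** This is where [a_small] enters: steps of size at most [a / (2 * eta ^+ 2)] are within the
    reach. *)
Lemma step_le s : 0 <= s -> s * (2 * eta ^+ 2) <= a -> s * (3 * L) <= 1.
Proof.
move=> s0 sa; rewrite -(ler_pM2r eta2) mul1r; apply: le_trans a_small.
by rewrite mulrAC ler_pM2r ?mulr_gt0.
Qed.

Lemma enorm_grad_sqr x : 2 * eta < enorm (grad g x) ->
  4 * eta ^+ 2 <= enorm (grad g x) ^+ 2.
Proof.
move=> N; have -> : 4 * eta ^+ 2 = (2 * eta) ^+ 2 by ring.
by rewrite lerXn2r ?nnegrE ?enorm_ge0 ?mulr_ge0 // ltW.
Qed.

(** A step against the gradient with linear decrease [2 * a]; the second-order error is at most a
    third of it, so the level [- a] is reached. *)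
Lemma sublevel_close c : g c = 0 ->
  exists2 x, S x & enorm (c - x) * enorm (grad g c) <= 2 * a.
Proof.
move=> gc; have cr := level0_lt_rad gc; have N := level0_grad gc.
set v := grad g c; set N2 := enorm v ^+ 2.
have N2eta : 4 * eta ^+ 2 <= N2 by exact: enorm_grad_sqr.
have N20 : 0 < N2 by apply: lt_le_trans N2eta; rewrite mulr_gt0 // exprn_gt0.
pose s : R := 2 * a / N2.
have s0 : 0 <= s by apply: divr_ge0 (ltW N20); exact: mulr_ge0.
have sN : s * N2 = 2 * a by rewrite divfK // gt_eqF.
have sL : s * (3 * L) <= 1 by apply: step_le => //; nra.
have sr := small_step cr s0 sL.
exists (c + s *: - v); last first.
  rewrite opprD addrA subrr add0r enormN scalerN enormN enormZ ger0_norm //.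
  by rewrite -mulrA -expr2 sN.
have xr : enorm (c + s *: - v) < 2 * rad.
  by apply: enorm_add_lt cr _; rewrite scalerN enormN.
have := first_order_up H (eball_rad H cr) xr.
rewrite gc add0r dotvZr dotvNr -enorm_sqr scalerN enormN enormZ ger0_norm // exprMn.
rewrite -/N2 mulrN sN expr2 -mulrA sN /S /= => /le_trans; apply.
have h : 0 <= a * (1 - s * (3 * L)) by rewrite mulr_ge0 ?subr_ge0.
by move: a_ge0 h; lra.
Qed.

(** The nearest point [p] of the compact [S] makes [c - p] a proximal normal. It lies on the level,
    since otherwise the normal would vanish and [c = p]. The distance bound of [sublevel_close] then
    controls [lambda]. *)
Lemma foot_exists c : g c = 0 -> exists p lambda, foot p c lambda /\
  enorm (c - p) * eta <= a.
Proof.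
move=> gc.
have S0 : S !=set0 by have [x Sx _] := sublevel_close gc; exists x.
have Sc : compact S by apply: (compact_sublevel H (_ : - a <= 0)); rewrite oppr_le0.
have cd : {within S, continuous (fun x : 'rV[R]_n => enorm (x - c))}.
  by apply: continuous_subspaceT; exact: enorm_sub_continuous.
have [p /set_mem Sp pmin] := EVT_min_rV S0 Sc cd.
have {}pmin x : S x -> enorm (c - p) <= enorm (c - x).
  by move=> Sx; rewrite enormBC (enormBC c); apply: pmin; rewrite inE.
have pP : proximal_normal_cone S p (c - p).
  (* Expanding [enorm (c - p) ^+ 2 <= enorm (c - x) ^+ 2] gives exactly the factor 1/2. *)
  split=> //; exists (1 / 2) => // x Sx; have := pmin x Sx.
  rewrite -(@ler_pXn2r _ 2) ?nnegrE ?enorm_ge0 //.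
  have -> : c - x = (c - p) - (x - p) by rewrite opprB addrA subrK.
  by rewrite (enorm_sub_sqr (c - p)); lra.
have gp : g p = - a.
  move: (Sp); rewrite /S /= le_eqVlt => /orP[/eqP //|gp].
  have /eqP := proximal_interior H a_ge0 a_le gp pP; rewrite subr_eq0 => /eqP cp.
  by move: gp a_ge0; rewrite -cp gc; lra.
have [lambda /= l0 lE] := proximal_sub_grad_cone H a_ge0 a_le gp pP.
have [x Sx xc] := sublevel_close gc.
have Nc := level0_grad gc; have Np := level_grad H a_ge0 a_le gp.
have cpa : enorm (c - p) * enorm (grad g c) <= 2 * a.
  by apply: le_trans xc; rewrite ler_wpM2r ?enorm_ge0 ?pmin.
have cpa2 : enorm (c - p) * eta <= a.
  by have := enorm_ge0 (c - p); nra.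
exists p, lambda; split=> //; split=> //; last by rewrite lE addrC subrK.
apply: step_le => //; move: cpa2; rewrite -lE enormZ ger0_norm //.
have := mulr_ge0 l0 (ltW eta0); nra.
Qed.

(** Intermediate values along the gradient at [p]: up to the step [a / (2 * eta ^+ 2)] the linear
    gain is at least [2 * a] and the error at most a third of that gain, so the level 0 is
    reached. *)
Lemma foot_inv_exists p : g p = - a -> exists c lambda, foot p c lambda.
Proof.
move=> gp; have Np := level_grad H a_ge0 a_le gp.
have pr := sublevel_lt_rad H a_ge0 (level_sublevel gp).
pose s : R := a / (2 * eta ^+ 2).
have s0 : 0 <= s by rewrite divr_ge0 // ltW.
have sa : s * (2 * eta ^+ 2) = a by rewrite divfK // gt_eqF.
have sL : s * (3 * L) <= 1 by apply: step_le => //; rewrite sa.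
have [|||lambda /andP[l0 ls] gl] := @ivt_line _ _ g (rs_diff H) p (grad g p) s 0 => //.
- by rewrite gp oppr_le0.
- have := first_order_low H (eball_rad H pr) (enorm_add_lt pr (small_step pr s0 sL)).
  rewrite gp dotvZr -enorm_sqr enormZ ger0_norm // exprMn; apply: le_trans.
  have := enorm_grad_sqr Np; set N2 := enorm _ ^+ 2 => N2eta.
  have N20 : 0 <= N2 := sqr_ge0 _.
  have h : s * (4 * eta ^+ 2) <= s * N2 by rewrite ler_wpM2l.
  have h2 : L * (s ^+ 2 * N2) <= 1 / 3 * (s * N2).
    have -> : L * (s ^+ 2 * N2) = s * L * (s * N2) by ring.
    rewrite (ler_wpM2r (mulr_ge0 s0 N20)) //; lra.
  by move: a_ge0; lra.
exists (p + lambda *: grad g p), lambda; split=> //.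
by apply: le_trans sL; rewrite ler_wpM2r // mulr_ge0 // ltW.
Qed.

(** The factor 1/3 is strictly below the 1/2 that characterizes a nearest point; this slack yields
    uniqueness and the Lipschitz bound. *)
Lemma foot_dotv_le p c lambda x : foot p c lambda -> S x ->
  dotv (c - p) (x - p) <= 1 / 3 * enorm (x - p) ^+ 2.
Proof.
move=> [gp gc l0 lL ->] Sx; rewrite (addrC p) addrK dotvZl.
apply: le_trans (ler_wpM2l l0 (dotv_level_le H a_ge0 gp Sx)) _.
by rewrite mulrA ler_wpM2r ?sqr_ge0 //; lra.
Qed.

Lemma foot_nearest p c lambda : foot p c lambda ->
  nearest_points [set x | g x = - a] c = [set p].
Proof.
move=> fp; have [gp _ _ _ _] := fp.
have dist x : g x = - a ->
    enorm (c - p) ^+ 2 + 1 / 3 * enorm (x - p) ^+ 2 <= enorm (c - x) ^+ 2.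
  move=> gx; have := foot_dotv_le fp (level_sublevel gx).
  have -> : c - x = (c - p) - (x - p) by rewrite opprB addrA subrK.
  by rewrite (enorm_sub_sqr (c - p)); lra.
apply/seteqP; split => [x /= [gx xmin]|_ ->]; last first.
  split=> // x gx; rewrite -(@ler_pXn2r _ 2) ?nnegrE ?enorm_ge0 //.
  by apply: le_trans (dist x gx); rewrite lerDl mulr_ge0 ?sqr_ge0.
have := xmin p gp; rewrite -(@ler_pXn2r _ 2) ?nnegrE ?enorm_ge0 // => xp.
apply/eqP; rewrite -subr_eq0; apply/eqP/enorm_eq0/eqP; rewrite -sqrf_eq0.
by rewrite eq_le sqr_ge0 andbT; have := dist x gx; lra.
Qed.

(** Adding the two inequalities of [foot_dotv_le] bounds [dotv (c1 - c2) (p1 - p2)] below by a third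
    of [enorm (p1 - p2) ^+ 2]; conclude by Cauchy-Schwarz. *)
Lemma foot_lipschitz p1 c1 l1 p2 c2 l2 : foot p1 c1 l1 -> foot p2 c2 l2 ->
  enorm (p1 - p2) <= 3 * enorm (c1 - c2).
Proof.
move=> f1 f2; have [g1 _ _ _ _] := f1; have [g2 _ _ _ _] := f2.
have h1 := foot_dotv_le f1 (level_sublevel g2).
have h2 := foot_dotv_le f2 (level_sublevel g1).
have h3 := dotv_le (c1 - c2) (p1 - p2).
have : 1 / 3 * enorm (p1 - p2) ^+ 2 <= dotv (c1 - c2) (p1 - p2).
  have -> : c1 - c2 = (c1 - p1) - (c2 - p2) + (p1 - p2).
    by apply/rowP => j; rewrite !mxE; ring.
  move: h1; rewrite enormBC -(opprB p1 p2) dotvNr => h1.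
  rewrite dotvDl (dotvDl _ (- (c2 - p2))) dotvNl -enorm_sqr; lra.
move=> h4; have [->|p0] := eqVneq (enorm (p1 - p2)) 0.
  by rewrite mulr_ge0 ?enorm_ge0.
have {}p0 : 0 < enorm (p1 - p2) by rewrite lt_neqAle eq_sym p0 enorm_ge0.
rewrite -(ler_pM2r p0); nra.
Qed.

(** The first summand accounts for moving the base point at a fixed multiplier, the second for the
    change of the multiplier. *)
Definition foot_inverse_lip : R := 4 / 3 * (1 + G ^+ 2 / (2 * eta ^+ 2)).

(** Within the reach the gradient moves by at most a third of its norm at [p], so the derivative
    along the ray is at least two thirds of [enorm (grad g p) ^+ 2], hence at least
    [2 * eta ^+ 2]. *)
Lemma foot_increase p l m : g p = - a -> 0 <= l -> l <= m -> m * (3 * L) <= 1 ->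
  (m - l) * (2 * eta ^+ 2) <= g (p + m *: grad g p) - g (p + l *: grad g p).
Proof.
move=> gp l0 lm mL; have Np := level_grad H a_ge0 a_le gp.
have pr := sublevel_lt_rad H a_ge0 (level_sublevel gp).
have [s /andP[s0 s1] ->] := mean_value (rs_diff H) (p + l *: grad g p) (p + m *: grad g p).
have -> : p + m *: grad g p - (p + l *: grad g p) = (m - l) *: grad g p.
  by rewrite opprD addrACA subrr add0r scalerBl.
have -> : p + l *: grad g p + s *: ((m - l) *: grad g p) =
    p + (l + s * (m - l)) *: grad g p.
  by rewrite scalerA -addrA -scalerDl.
set k := l + _.
have k0 : 0 <= k by rewrite addr_ge0 // mulr_ge0 ?subr_ge0 // ltW.
have km : k <= m.
  have ml : 0 <= m - l by rewrite subr_ge0.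
  by have := ler_wpM2r ml (ltW s1); rewrite /k; lra.
have kL : k * (3 * L) <= 1.
  by apply: le_trans mL; rewrite ler_wpM2r // mulr_ge0 // ltW.
rewrite dotvZr ler_wpM2l ?subr_ge0 //.
have := rs_lip H (enorm_add_lt pr (small_step pr k0 kL)) (eball_rad H pr).
rewrite (addrC p) addrK enormZ ger0_norm // => hL.
have h := dotv_abs_le (grad g (k *: grad g p + p) - grad g p) (grad g p).
move: h; rewrite ler_norml => /andP[h _].
have := enorm_grad_sqr Np; set N := enorm (grad g p) in hL h * => N2eta.
have {}hL : enorm (grad g (k *: grad g p + p) - grad g p) * N <= 1 / 3 * N ^+ 2.
  apply: le_trans (ler_wpM2r (enorm_ge0 _) hL) _.
  have -> : L * (k * N) * N = (k * L) * N ^+ 2 by ring.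
  by rewrite ler_wpM2r ?sqr_ge0 //; lra.
move: h; rewrite dotvDl dotvNl -(enorm_sqr (grad g p)) -/N; nra.
Qed.

Lemma foot_inverse_lipschitz p1 c1 l1 p2 c2 l2 : foot p1 c1 l1 -> foot p2 c2 l2 ->
  enorm (c1 - c2) <= foot_inverse_lip * enorm (p1 - p2).
Proof.
wlog l12 : p1 c1 l1 p2 c2 l2 / l1 <= l2 => [hw f1 f2|].
  have [l12|/ltW l21] := leP l1 l2; first exact: hw f1 f2.
  by rewrite enormBC (enormBC p1); exact: hw f2 f1.
move=> [g1 gc1 l10 l1L c1E] [g2 gc2 l20 l2L c2E].
have p1r := sublevel_lt_rad H a_ge0 (level_sublevel g1).
have p2r := sublevel_lt_rad H a_ge0 (level_sublevel g2).
have G0 : 0 < G := grad_bound_gt0 H.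
have d0 := enorm_ge0 (p1 - p2).
(* [q] has the base point of [c2] and the multiplier of [c1]. As [g c1 = g c2 = 0], the value [g q]
   is controlled by [enorm (c1 - q)], and [foot_increase] turns this into a bound on [l2 - l1]. *)
pose q := p2 + l1 *: grad g p2.
have dq : enorm (c1 - q) <= 4 / 3 * enorm (p1 - p2).
  have -> : c1 - q = (p1 - p2) + l1 *: (grad g p1 - grad g p2).
    by rewrite c1E opprD addrACA scalerBr.
  apply: le_trans (enorm_triangle _ _) _; rewrite enormZ ger0_norm //.
  have := ler_wpM2l l10 (rs_lip H (eball_rad H p1r) (eball_rad H p2r)).
  have := ler_wpM2r d0 l1L; lra.
have dl : (l2 - l1) * (2 * eta ^+ 2) <= G * (4 / 3 * enorm (p1 - p2)).
  apply: le_trans (foot_increase g2 l10 l12 l2L) _.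
  have := sublevel_lipschitz H (enorm_add_lt p2r (small_step p2r l10 l1L))
    (_ : enorm c1 < 2 * rad).
  rewrite {1}c1E => /(_ (enorm_add_lt p1r (small_step p1r l10 l1L))).
  rewrite -c2E gc1 gc2 -/q -/G sub0r normrN => h.
  apply: (@le_trans _ _ (G * enorm (c1 - q))); last by rewrite ler_pM2l.
  by apply: le_trans h; rewrite -normrN ler_norm.
have dc : enorm (q - c2) <= (l2 - l1) * G.
  have -> : q - c2 = (l1 - l2) *: grad g p2.
    by rewrite c2E opprD addrACA subrr add0r scalerBl.
  rewrite enormZ distrC ger0_norm ?subr_ge0 // ler_wpM2l ?subr_ge0 //.
  exact: (grad_le H (eball_rad H p2r)).
apply: le_trans (enormB_triangle q _ _) _.
have : (l2 - l1) * G <= 4 / 3 * (G ^+ 2 / (2 * eta ^+ 2)) * enorm (p1 - p2).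
  rewrite -(ler_pM2r eta2).
  have -> : 4 / 3 * (G ^+ 2 / (2 * eta ^+ 2)) * enorm (p1 - p2) * (2 * eta ^+ 2) =
     G * (4 / 3 * enorm (p1 - p2)) * G by field; rewrite gt_eqF.
  by rewrite mulrAC ler_pM2r.
rewrite /foot_inverse_lip; lra.
Qed.

Lemma bilipschitz_level :
  bilipschitz_projection 3 foot_inverse_lip [set x | g x = 0] [set x | g x = - a].
Proof.
(* The implication makes the choice total; off the level set the witness is the point itself. *)
have exP c : exists p, g c = 0 -> exists lambda, foot p c lambda.
  have [/foot_exists[p [lambda [fp _]]]|gc] := pselect (g c = 0).
    by exists p => _; exists lambda.
  by exists c.
have exQ p : exists c, g p = - a -> exists lambda, foot p c lambda.
  have [/foot_inv_exists[c [lambda fp]]|gp] := pselect (g p = - a).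
    by exists c => _; exists lambda.
  by exists p.
have [P PP] := choice exP; have [Q QP] := choice exQ.
have inj p c1 l1 c2 l2 : foot p c1 l1 -> foot p c2 l2 -> c1 = c2.
  move=> f1 f2; apply/eqP; rewrite -subr_eq0; apply/eqP/enorm_eq0/eqP.
  rewrite eq_le enorm_ge0 andbT; have := foot_inverse_lipschitz f1 f2.
  by rewrite subrr enorm0 mulr0.
have fun_ p1 l1 p2 l2 c : foot p1 c l1 -> foot p2 c l2 -> p1 = p2.
  move=> f1 f2; apply/eqP; rewrite -subr_eq0; apply/eqP/enorm_eq0/eqP.
  rewrite eq_le enorm_ge0 andbT; have := foot_lipschitz f1 f2.
  by rewrite subrr enorm0 mulr0.
exists P, Q; split.
- by move=> c /PP[lambda] /foot_nearest.
- split.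
  + by move=> c /PP[lambda []].
  + move=> c1 c2; rewrite !inE => /PP[l1 f1] /PP[l2 f2] P12.
    by rewrite P12 in f1; exact: inj f1 f2.
  + move=> p /foot_inv_exists[c [lambda fc]]; exists c; first by case: fc.
    have [_ gc _ _ _] := fc; have [l2 f2] := PP c gc; exact: fun_ f2 fc.
- by move=> c1 c2 /PP[l1 f1] /PP[l2 f2]; exact: foot_lipschitz f1 f2.
- move=> c /PP[l1 f1]; have [gp _ _ _ _] := f1; have [l2 f2] := QP _ gp.
  exact: inj f2 f1.
- by move=> p1 p2 /QP[l1 f1] /QP[l2 f2]; exact: foot_inverse_lipschitz f1 f2.
Qed.

End Projection.

(** * Lipschitz arcs and quasiconvexity *)

(* The derivative of a Lipschitz curve is only compared with a constant, so its
   measurability is never needed. *)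
Lemma ge0_le_integral_nonmeasurable d (T : measurableType d) (R : realType)
    (mu : {measure set T -> \bar R}) (D : set T) (f1 f2 : T -> \bar R) :
  (forall x, D x -> (0 <= f1 x)%E) -> (forall x, D x -> (f1 x <= f2 x)%E) ->
  (\int[mu]_(x in D) f1 x <= \int[mu]_(x in D) f2 x)%E.
Proof.
move=> f10 f12; rewrite !ge0_integralE //; last first.
  by move=> x Dx; apply: le_trans (f10 x Dx) (f12 x Dx).
apply: ereal_sup_le => _ [h hf <-].
exists h => // x; apply: le_trans (hf x) _; apply: lee_restrict => //.
Qed.

Lemma min_lipschitz (R : realType) (a s t : R) :
  `|Num.min s a - Num.min t a| <= `|s - t|.
Proof.
case: (leP s a) => sa; case: (leP t a) => ta //.
- by rewrite (distrC s a) (distrC s t) !ger0_norm ?subr_ge0 //; lra.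
- by rewrite !ger0_norm ?subr_ge0 //; lra.
- by rewrite subrr normr0.
Qed.

Lemma max_lipschitz (R : realType) (a s t : R) :
  `|Num.max a s - Num.max a t| <= `|s - t|.
Proof.
have maxE (u : R) : Num.max a u = - Num.min (- u) (- a).
  by rewrite -oppr_max opprK maxC.
by rewrite !maxE -opprD normrN -(normrN (s - t)) opprD min_lipschitz.
Qed.

Section Arcs.
Variables (R : realType) (n : nat).
Implicit Types (S : set 'rV[R]_n) (x y z : 'rV[R]_n) (F : R -> 'rV[R]_n).

(* Where [F] is not differentiable, [derive1 F s] is the default point, i.e. 0. *)
Lemma enorm_derive1_le F (l s : R) :
  (forall a b, enorm (F a - F b) <= l * `|a - b|) -> enorm (derive1 F s) <= l.
Proof.
move=> Fl; have l0 : 0 <= l.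
  by have := le_trans (enorm_ge0 _) (Fl 1 0); rewrite subr0 normr1 mulr1.
rewrite /derive1; set q := (X in X @ _).
have [cq|dq] := pselect (cvg (q h @[h --> 0^'])); last first.
  rewrite (dvgP dq); suff -> : (point : 'rV[R]_n) = 0 by rewrite enorm0.
  by apply/rowP => j; rewrite !mxE.
rewrite -[X in enorm X]subr0.
have cA : closed (fun x : 'rV[R]_n => enorm (x - 0) <= l) by exact: closed_enorm_le.
apply: (@closed_cvg _ _ _ _ q _ cA _ _ cq).
near=> h; have h0 : h != 0 by near: h; exact: nbhs_dnbhs_neq.
rewrite subr0 /q enormZ normfV mulrC ler_pdivrMr ?normr_gt0 //.
by apply: le_trans (Fl _ _) _; rewrite addrK.
Unshelve. all: by end_near. Qed.

Lemma curve_length_le F (l : R) :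
  (forall a b, enorm (F a - F b) <= l * `|a - b|) -> (curve_length F <= l%:E)%E.
Proof.
move=> Fl; apply: (@le_trans _ _ (\int[lebesgue_measure]_(s in `[0%R, 1%R]) (cst l%:E) s)%E).
  apply: ge0_le_integral_nonmeasurable => x _; first by rewrite lee_fin enorm_ge0.
  by rewrite lee_fin enorm_derive1_le.
by rewrite integral_cst //= lebesgue_measure_itv /= lte01 oppr0 adde0 mule1.
Qed.

(* [F] is total but 1-Lipschitz and [S]-valued everywhere, which makes
   concatenation, extension and reparametrization free of side conditions. *)
Definition arc S x y (l : R) := exists F : R -> 'rV[R]_n,
  [/\ forall a b, enorm (F a - F b) <= `|a - b|, forall s, S (F s),
      F 0 = x & F l = y].

Lemma arc_refl S x : S x -> arc S x x 0.
Proof. by move=> Sx; exists (fun=> x); split => // a b; rewrite subrr enorm0. Qed.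

Lemma arc_le S x y (a b : R) : 0 <= a -> a <= b -> arc S x y a -> arc S x y b.
Proof.
move=> a0 ab [F [Fl FS F0 Fa]]; exists (fun s => F (Num.min s a)); split => //.
- by move=> s t; apply: le_trans (Fl _ _) _; exact: min_lipschitz.
- by rewrite (min_idPl _).
- by rewrite (min_idPr _).
Qed.

Lemma arc_trans S x y z (a b : R) : 0 <= a -> 0 <= b ->
  arc S x y a -> arc S y z b -> arc S x z (a + b).
Proof.
move=> a0 b0 [F [Fl FS F0 Fa]] [F' [F'l F'S F'0 F'b]].
exists (fun s => if s <= a then F s else F' (s - a)).
have mixed s t : s <= a -> a < t -> enorm (F s - F' (t - a)) <= t - s.
  move=> sa at_; apply: le_trans (enormB_triangle y _ _) _.
  rewrite -{1}Fa -F'0; have := Fl s a; have := F'l 0 (t - a).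
  rewrite (distrC s) sub0r normrN !ger0_norm ?subr_ge0 ?(ltW at_) //; lra.
split.
- move=> s t; case: (leP s a) => sa; case: (leP t a) => ta.
  + exact: Fl.
  + by apply: le_trans (mixed _ _ sa ta) _; rewrite distrC ler_norm.
  + by rewrite enormBC; apply: le_trans (mixed _ _ ta sa) _; rewrite ler_norm.
  + by apply: le_trans (F'l _ _) _; rewrite opprB addrA subrK.
- by move=> s; case: ifP.
- by rewrite a0.
(* If [b = 0], the value at [a + b] is taken from the first branch, which ends at [y]; then
   [z = y]. *)
- have [b00|b_gt0] := leP (a + b) a; last by rewrite addrAC subrr add0r.
  have -> : b = 0 by apply/eqP; rewrite eq_le b0 andbT; lra.
  have -> : z = y by rewrite -F'0 -F'b; congr F'; lra.
  by rewrite addr0.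
Qed.

(** Slowing time down by [K] makes the image curve 1-Lipschitz again. *)
Lemma arc_map S S' (P : 'rV[R]_n -> 'rV[R]_n) (K : R) x y l : 0 < K ->
  elipschitz_on K S P -> (forall x, S x -> S' (P x)) ->
  arc S x y l -> arc S' (P x) (P y) (K * l).
Proof.
move=> K0 PK PS [F [Fl FS F0 Fa]]; exists (fun s => P (F (s / K))); split.
- move=> s t; apply: le_trans (PK _ _ (FS _) (FS _)) _.
  apply: le_trans (ler_wpM2l (ltW K0) (Fl _ _)) _.
  by rewrite -mulrBl normrM normfV (gtr0_norm K0) mulrCA divff ?gt_eqF // mulr1.
- by move=> s; exact: PS.
- by rewrite mul0r F0.
- by rewrite mulrAC divff ?gt_eqF // mul1r Fa.
Qed.

Lemma quasiconvex_arc S (beta : R) : 0 <= beta ->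
  (forall x y, S x -> S y -> arc S x y (beta * enorm (y - x))) ->
  quasiconvex beta S.
Proof.
move=> beta0 Sarc x y Sx Sy; have [F [Fl FS F0 Fa]] := Sarc x y Sx Sy.
set l := beta * _ in Fa *.
have l0 : 0 <= l by rewrite /l mulr_ge0 ?enorm_ge0.
have lip a b : enorm (F (l * a) - F (l * b)) <= l * `|a - b|.
  by apply: le_trans (Fl _ _) _; rewrite -mulrBr normrM ger0_norm.
exists (fun s => F (l * s)); split => //.
- by exists l => s t _ _; exact: lip.
- by rewrite mulr0.
- by rewrite mulr1.
- exact: curve_length_le.
Qed.

End Arcs.

(** * From short arcs to all arcs, by connectedness and a finite grid *)

Section ChainArcs.
Variables (R : realType) (n : nat) (rad delta kappa : R).
Hypotheses (delta0 : 0 < delta) (kappa0 : 0 < kappa).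
Variable S : set 'rV[R]_n.
Hypothesis S_rad : S `<=` eball rad.
Hypothesis S_conn : connected S.
Hypothesis S_arc : forall x y, S x -> S y -> enorm (y - x) <= delta ->
  arc S x y (kappa * enorm (y - x)).
Implicit Types (x y z : 'rV[R]_n).

(** Points of one cell differ by at most [mesh] in each coordinate, hence by at most
    [n%:R * mesh <= delta] in Euclidean norm. *)
Definition mesh : R := delta / n.+1%:R.
Definition ncell : nat := Num.truncn (2 * rad / mesh).
(** Points of [S] have indices at most [ncell], so on [S] the default value of [inord] never
    occurs. *)
Definition cell x : {ffun 'I_n -> 'I_ncell.+1} :=
  [ffun j => inord (Num.truncn ((x 0 j + rad) / mesh))].

Lemma mesh_gt0 : 0 < mesh. Proof. by rewrite divr_gt0. Qed.

Lemma cell_close x y : S x -> S y -> cell x = cell y -> enorm (y - x) <= delta.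
Proof.
move=> Sx Sy /ffunP xy; apply: (@le_trans _ _ (n%:R * mesh)); last first.
  rewrite /mesh mulrCA; apply: ler_piMr; first exact: ltW.
  by rewrite ler_pdivrMr ?ltr0n // mul1r ler_nat.
apply: enorm_le_coord => j; rewrite !mxE.
have bound z : S z -> 0 <= (z 0 j + rad) / mesh <= 2 * rad / mesh.
  move=> /S_rad zr; have := le_lt_trans (coord_le_enorm z j) zr.
  rewrite ltr_norml => /andP[z1 z2].
  have zr0 : 0 <= z 0 j + rad by move: z1; lra.
  rewrite (divr_ge0 zr0 (ltW mesh_gt0)) /=.
  by rewrite ler_pM2r ?invr_gt0 ?mesh_gt0 //; move: z2; lra.
have trunc_lt z : S z -> (Num.truncn ((z 0 j + rad) / mesh)%R < ncell.+1)%N.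
  by move=> /bound /andP[_ h]; rewrite ltnS; exact: le_truncn.
have := congr1 val (xy j); rewrite !ffunE /= !inordK ?trunc_lt // => eq_trunc.
have /andP[/truncn_itv/andP[x1 x2] _] := bound x Sx.
have /andP[/truncn_itv/andP[y1 y2] _] := bound y Sy.
rewrite -(ler_pM2r (_ : 0 < mesh^-1)) ?invr_gt0 ?mesh_gt0 // divff ?gt_eqF ?mesh_gt0 //.
rewrite -[mesh^-1]gtr0_norm ?invr_gt0 ?mesh_gt0 // -normrM mulrBl ler_norml.
move: x1 x2 y1 y2; rewrite eq_trunc !mulrDl -!natr1; lra.
Qed.

Definition linked : rel {ffun 'I_n -> 'I_ncell.+1} := fun i j =>
  `[< exists x y, [/\ S x, S y, cell x = i, cell y = j & enorm (y - x) <= delta] >].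

Lemma open_fattening (B : set 'rV[R]_n) :
  open [set w | exists2 z, B z & enorm (w - z) < delta].
Proof.
rewrite openE => w [z Bz wz]; apply/nbhs_enormP.
exists (delta - enorm (w - z)) => [|y yw]; first by rewrite subr_gt0.
by exists z => //; apply: le_lt_trans (enormB_triangle w _ _) _; rewrite -ltrBrDr.
Qed.

(** The points of [S] whose cell is reachable from that of [x] form a set both open and closed in
    [S], because reachability passes to every point of [S] closer than [delta]. *)
Lemma connect_linked x y : S x -> S y -> connect linked (cell x) (cell y).
Proof.
move=> Sx Sy; pose B := S `&` [set z | connect linked (cell x) (cell z)].
have step z w : B z -> S w -> enorm (w - z) < delta -> B w.
  move=> [Sz xz] Sw wz; split=> //; apply: connect_trans xz (connect1 _).
  by apply/asboolP; exists z, w; split => //; exact: ltW.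
have BS : B = S.
  apply: S_conn.
  - by exists x; split => //; exact: connect0.
  - exists [set w | exists2 z, B z & enorm (w - z) < delta].
      exact: open_fattening.
    apply/seteqP; split => [w Bw|w [Sw [z Bz wz]]]; last exact: step wz.
    by split; [case: Bw | exists w => //; rewrite subrr enorm0].
  (* Closedness: no reachable point is within [delta] of an unreachable one. *)
  - exists (~` [set w | exists2 z, (S `\` B) z & enorm (w - z) < delta]).
      by apply: open_closedC; exact: open_fattening.
    apply/seteqP; split => [w Bw|w [Sw wN]].
      split; first by case: Bw.
      by move=> [z [Sz Bz] wz]; apply: Bz; apply: step Bw Sz _; rewrite enormBC.
    apply: contrapT => Bw; apply: wN; exists w; first by split.
    by rewrite subrr enorm0.
by have : B y; [rewrite BS | case].
Qed.

(** Each link of a path costs two short arcs, one inside a cell and one across the link; one more is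
    spent in the last cell. *)
Definition chain_const : R :=
  kappa * (2 * #|{ffun 'I_n -> 'I_ncell.+1}|%:R + 1).

Lemma arc_path p i x y : path linked i p -> S x -> cell x = i ->
  S y -> cell y = last i p -> arc S x y (kappa * delta * (2 * (size p)%:R + 1)).
Proof.
have kd0 : 0 < kappa * delta by rewrite mulr_gt0.
have short u v : S u -> S v -> enorm (v - u) <= delta -> arc S u v (kappa * delta).
  move=> Su Sv uv; apply: arc_le (S_arc Su Sv uv).
    by rewrite mulr_ge0 ?enorm_ge0 // ltW.
  by rewrite ler_pM2l.
elim: p i x y => [|j p IHp] i x y /=.
  move=> _ Sx xi Sy yi; rewrite mulr0 add0r mulr1.
  by apply: short => //; apply: cell_close => //; rewrite xi yi.
move=> /andP[/asboolP[x' [y' [Sx' Sy' x'i y'j xy']]] pp] Sx xi Sy yl.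
have -> : kappa * delta * (2 * (size p).+1%:R + 1) =
    kappa * delta + (kappa * delta + kappa * delta * (2 * (size p)%:R + 1)).
  by rewrite -natr1; ring.
have tail0 : 0 <= kappa * delta * (2 * (size p)%:R + 1).
  by rewrite mulr_ge0 ?ltW // addr_ge0 ?mulr_ge0.
apply: (arc_trans (ltW kd0) _ (y := x')); first by rewrite addr_ge0 // ltW.
  by apply: short => //; apply: cell_close => //; rewrite xi x'i.
apply: (arc_trans (ltW kd0) tail0 (y := y')); first exact: short.
exact: IHp pp Sy' y'j Sy yl.
Qed.

Lemma chain_arc x y : S x -> S y -> arc S x y (chain_const * enorm (y - x)).
Proof.
move=> Sx Sy; set N := #|{ffun 'I_n -> 'I_ncell.+1}|.
have [xy|xy] := leP (enorm (y - x)) delta.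
  apply: arc_le (S_arc Sx Sy xy); first by rewrite mulr_ge0 ?enorm_ge0 // ltW.
  apply: ler_wpM2r (enorm_ge0 _) _ _ _.
  by rewrite /chain_const (ler_peMr (ltW kappa0)) // lerDr mulr_ge0.
have /connectP[p0 pp0 ly] := connect_linked Sx Sy.
(* A repetition-free path has at most as many links as there are cells. Its total length is a
   multiple of [delta], which is less than [enorm (y - x)] here. *)
case: (shortenP pp0) ly => p pp up _ ly.
have sizep : (size p <= N)%N.
  by have /andP[_ /card_uniqP <-] := up; exact: max_card.
apply: arc_le (arc_path pp Sx erefl Sy ly).
  by rewrite !mulr_ge0 ?addr_ge0 ?mulr_ge0 // ltW.
rewrite /chain_const -!mulrA ler_pM2l // mulrC.
apply: ler_pM; rewrite ?addr_ge0 ?mulr_ge0 ?(ltW delta0) ?(ltW xy) //.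
by rewrite lerD2r ler_pM2l // ler_nat.
Qed.

End ChainArcs.

(** * Arcs in the zero level *)

Section LevelArcs.
Variables (R : realType) (n : nat) (g : 'rV[R]_n -> R) (rad L eta eps : R).
Hypothesis H : regular_sublevel g rad L eta eps.
Implicit Types (x y z v w p c : 'rV[R]_n) (s t : R).

Let rad0 : 0 < rad. Proof. exact: rs_rad H. Qed.
Let L0 : 0 < L. Proof. exact: rs_L H. Qed.
Let eta0 : 0 < eta. Proof. exact: rs_eta H. Qed.
Let G := grad_bound rad L.
Let G0 : 0 < G. Proof. exact: grad_bound_gt0 H. Qed.

(** Lipschitz constant of the graph map: 1 for the base point and [G / eta] for the height above
    it. *)
Definition arc_ratio : R := 1 + G / eta.
(** Base offset plus height is then at most [Num.min (eta / L) rad]: the slope in the direction [u]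
    stays at least [eta], and the point stays in the ball of radius [2 * rad]. *)
Definition arc_radius : R := Num.min (eta / L) rad / arc_ratio.

Lemma arc_ratio_gt0 : 0 < arc_ratio.
Proof. by rewrite ltr_pwDl // divr_ge0 // ltW. Qed.

Lemma arc_radius_gt0 : 0 < arc_radius.
Proof. by rewrite divr_gt0 ?arc_ratio_gt0 // lt_min rad0 divr_gt0. Qed.

Lemma arc_radius_small : L * (arc_radius * arc_ratio) <= eta /\
  arc_radius * arc_ratio <= rad.
Proof.
rewrite divfK ?gt_eqF ?arc_ratio_gt0 //; split; last by rewrite ge_min lexx orbT.
by rewrite mulrC -ler_pdivlMr // ge_min lexx.
Qed.

Section Graph.
Variable x : 'rV[R]_n.
Hypothesis gx : g x = 0.

Let u := (enorm (grad g x))^-1 *: grad g x.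

Lemma grad_at : 2 * eta < enorm (grad g x).
Proof. exact: level0_grad H _ gx. Qed.

Lemma grad_at_gt0 : 0 < enorm (grad g x).
Proof. by apply: lt_trans grad_at; rewrite mulr_gt0. Qed.

Lemma enorm_direction : enorm u = 1.
Proof.
have N0 := grad_at_gt0.
by rewrite /u enormZ ger0_norm ?invr_ge0 ?ltW // mulVf // gt_eqF.
Qed.

Lemma graph_ball z s : enorm (z - x) + `|s| <= arc_radius * arc_ratio ->
  enorm (z + s *: u) < 2 * rad /\ enorm (z + s *: u - x) <= arc_radius * arc_ratio.
Proof.
move=> zs; have [_ rr] := arc_radius_small; have xr := level0_lt_rad H gx.
have h : enorm (z + s *: u - x) <= enorm (z - x) + `|s|.
  rewrite addrAC; apply: le_trans (enorm_triangle _ _) _.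
  by rewrite enormZ enorm_direction mulr1.
split; last exact: le_trans h zs.
have := enorm_triangle (z + s *: u - x) x; rewrite subrK; move: xr rr h zs; lra.
Qed.

(** At [x] the slope exceeds [2 * eta], and on this neighbourhood the gradient varies by at most
    [eta]. *)
Lemma graph_slope z s : enorm (z - x) + `|s| <= arc_radius * arc_ratio ->
  eta <= dotv (grad g (z + s *: u)) u.
Proof.
move=> /graph_ball[zr zx]; have [rL _] := arc_radius_small.
have xr := eball_rad H (level0_lt_rad H gx).
have -> : grad g (z + s *: u) = grad g x + (grad g (z + s *: u) - grad g x).
  by rewrite (addrC (grad g x)) subrK.
rewrite dotvDl {1}/u dotvZr -enorm_sqr expr2 mulKf ?gt_eqF ?grad_at_gt0 //.
have := dotv_abs_le (grad g (z + s *: u) - grad g x) u.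
rewrite enorm_direction mulr1 ler_norml => /andP[h _].
have h2 := rs_lip H zr xr.
have h3 := le_trans (ler_wpM2l (ltW L0) zx) rL.
move: grad_at h h2 h3; lra.
Qed.

Lemma graph_increase z s t : s <= t ->
  enorm (z - x) + `|s| <= arc_radius * arc_ratio ->
  enorm (z - x) + `|t| <= arc_radius * arc_ratio ->
  eta * (t - s) <= g (z + t *: u) - g (z + s *: u).
Proof.
move=> st zs zt.
have [k /andP[k0 k1] ->] := mean_value (rs_diff H) (z + s *: u) (z + t *: u).
have -> : z + t *: u - (z + s *: u) = (t - s) *: u.
  by rewrite opprD addrACA subrr add0r scalerBl.
have -> : z + s *: u + k *: ((t - s) *: u) = z + (s + k * (t - s)) *: u.
  by rewrite (scalerA k) -addrA -scalerDl.
rewrite dotvZr mulrC ler_wpM2l ?subr_ge0 //; apply: graph_slope.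
have h : `|s + k * (t - s)| <= Num.max `|s| `|t|.
  have h0 : 0 <= k * (t - s) by rewrite mulr_ge0 ?subr_ge0 // ltW.
  have h1 : k * (t - s) <= t - s by rewrite ler_piMl ?subr_ge0 // ltW.
  rewrite le_max !ler_norml; have := ler_norm t; have := ler_norm (- s).
  rewrite normrN => hs ht; have [t0|t0] := leP 0 (s + k * (t - s)).
    by apply/orP; right; apply/andP; split; lra.
  by apply/orP; left; apply/andP; split; lra.
by move: h; rewrite le_max => /orP[] h; move: zs zt; lra.
Qed.

(** [w] is a zero of [g] on the line through [z] with direction [u]. The base point ranges over a
    whole ball, not over a hyperplane, so that the segment between two points of the level can be
    projected as it is. *)
Definition graph_point z w := enorm (z - x) <= arc_radius /\
  exists s, [/\ `|s| <= G / eta * arc_radius, w = z + s *: u & g w = 0].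

Lemma graph_range z s : enorm (z - x) <= arc_radius -> `|s| <= G / eta * arc_radius ->
  enorm (z - x) + `|s| <= arc_radius * arc_ratio.
Proof. by move=> zx sr; rewrite mulrDr mulr1 mulrC lerD. Qed.

(** At the extreme heights the slope [eta] outweighs the bound [G * arc_radius] on the absolute
    value of [g z], so [g] changes sign in between. *)
Lemma graph_exists z : enorm (z - x) <= arc_radius -> exists w, graph_point z w.
Proof.
move=> zx; have r0 := arc_radius_gt0.
pose t := G / eta * arc_radius.
have t0 : 0 <= t := mulr_ge0 (divr_ge0 (ltW G0) (ltW eta0)) (ltW r0).
have tE : eta * t = G * arc_radius by rewrite /t; field; rewrite gt_eqF.
have zxr s : `|s| <= t -> enorm (z - x) + `|s| <= arc_radius * arc_ratio.
  exact: graph_range.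
have nt : `|t| <= t by rewrite ger0_norm.
have nNt : `|- t| <= t by rewrite normrN ger0_norm.
have n0t : `|0 : R| <= t by rewrite normr0.
have gz : `|g z| <= eta * t.
  have xr := eball_rad H (level0_lt_rad H gx).
  have [zr _] := graph_ball (zxr _ n0t); rewrite scale0r addr0 in zr.
  have := sublevel_lipschitz H xr zr; rewrite gx subr0 tE => /le_trans; apply.
  by rewrite ler_pM2l.
have up := graph_increase t0 (zxr _ n0t) (zxr _ nt).
have Nt0 : - t <= 0 by rewrite oppr_le0.
have down := graph_increase Nt0 (zxr _ nNt) (zxr _ n0t).
rewrite scale0r addr0 in up down.
move: gz; rewrite ler_norml => /andP[gz1 gz2].
have [|||s /andP[s0 st] gs] := @ivt_line _ _ g (rs_diff H) (z + (- t) *: u) u (2 * t) 0.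
- by rewrite mulr_ge0.
- by move: down gz2; lra.
- rewrite -addrA -scalerDl; have -> : - t + 2 * t = t by ring.
  by move: up gz1; lra.
exists (z + (- t) *: u + s *: u); split=> //; exists (- t + s); split => //.
- by rewrite -/t ler_norml; apply/andP; split; lra.
- by rewrite -addrA -scalerDl.
Qed.

(** Transport the lower height [s] to the base point [z']: there [g] is at most [G * enorm (z - z')]
    in absolute value, and the slope [eta] bounds [s' - s]. *)
Lemma graph_lipschitz z w z' w' : graph_point z w -> graph_point z' w' ->
  enorm (w - w') <= arc_ratio * enorm (z - z').
Proof.
move=> [zx [s [sr wE gw]]] [zx' [s' [sr' wE' gw']]].
wlog ss : z w z' w' s s' zx sr wE gw zx' sr' wE' gw' / s <= s' => [hw|].
  have [ss|/ltW ss] := leP s s'; first exact: (hw z w z' w' s s').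
  by rewrite enormBC (enormBC z); exact: (hw z' w' z w s' s).
have r1 := graph_range zx sr; have r1' := graph_range zx' sr'.
have r2 := graph_range zx' sr.
have [b1 _] := graph_ball r1; have [b2 _] := graph_ball r2.
have h := graph_increase ss r2 r1'.
rewrite -wE' gw' sub0r in h.
have := sublevel_lipschitz H b2 b1; rewrite -wE gw sub0r normrN => h2.
have e1 : z + s *: u - (z' + s *: u) = z - z' by rewrite opprD addrACA subrr addr0.
have e2 : w - (z' + s *: u) = z - z' by rewrite wE e1.
rewrite e2 in h2.
have h3 : s' - s <= G / eta * enorm (z - z').
  rewrite -(ler_pM2l eta0); have -> : eta * (G / eta * enorm (z - z')) = G * enorm (z - z').
    by field; rewrite gt_eqF.
  by apply: le_trans h _; apply: le_trans h2; rewrite -normrN ler_norm.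
have -> : w - w' = (z - z') + (s - s') *: u.
  by rewrite wE wE' opprD addrACA scalerBl.
apply: le_trans (enorm_triangle _ _) _.
rewrite enormZ enorm_direction mulr1 distrC ger0_norm ?subr_ge0 //.
rewrite /arc_ratio; lra.
Qed.

Lemma graph_point_self z : enorm (z - x) <= arc_radius -> g z = 0 -> graph_point z z.
Proof.
move=> zx gz; split=> //; exists 0; split => //.
  rewrite normr0; exact: mulr_ge0 (divr_ge0 (ltW G0) (ltW eta0)) (ltW arc_radius_gt0).
by rewrite scale0r addr0.
Qed.

Lemma level_arc y : g y = 0 -> enorm (y - x) <= arc_radius ->
  arc [set w | g w = 0] x y (arc_ratio * enorm (y - x)).
Proof.
move=> gy yx; set l := arc_ratio * _.
have [yx0|yx_neq0] := eqVneq (enorm (y - x)) 0.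
  have /eqP := enorm_eq0 yx0; rewrite subr_eq0 => /eqP ->.
  by rewrite /l yx0 mulr0; exact: arc_refl.
have yx_gt0 : 0 < enorm (y - x) by rewrite lt_neqAle eq_sym yx_neq0 enorm_ge0.
have l0 : 0 < l by rewrite mulr_gt0 ?arc_ratio_gt0.
(* Clamping time to [[0, l]] makes the curve total while its base points stay on the segment from
   [x] to [y]. *)
pose clamp (s : R) := Num.max 0 (Num.min s l).
have clamp0 s : 0 <= clamp s by rewrite le_max lexx.
have clampl s : clamp s <= l by rewrite ge_max (ltW l0) ge_min lexx orbT.
have clamp_lip s t : `|clamp s - clamp t| <= `|s - t|.
  exact: le_trans (max_lipschitz _ _ _) (min_lipschitz _ _ _).
pose z s := x + (clamp s / l) *: (y - x).
have zx s : enorm (z s - x) <= arc_radius.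
  rewrite /z (addrC x) addrK enormZ ger0_norm ?divr_ge0 ?(ltW l0) //.
  apply: le_trans yx; rewrite ler_piMl ?enorm_ge0 // ler_pdivrMr // mul1r.
  exact: clampl.
have [F FP] := choice (fun s => graph_exists (zx s)).
(* Uniqueness over a common base point identifies the chosen end points with [x] and [y]. *)
have same z0 w w' : graph_point z0 w -> graph_point z0 w' -> w = w'.
  move=> h h'; apply/eqP; rewrite -subr_eq0; apply/eqP/enorm_eq0/eqP.
  by rewrite eq_le enorm_ge0 andbT; have := graph_lipschitz h h'; rewrite subrr enorm0 mulr0.
exists F; split.
- move=> s t; apply: le_trans (graph_lipschitz (FP s) (FP t)) _.
  have -> : z s - z t = ((clamp s - clamp t) / l) *: (y - x).
    by rewrite /z opprD addrACA subrr add0r -scalerBl mulrBl.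
  rewrite enormZ mulrCA -/l normrM normfV (gtr0_norm l0).
  by rewrite -mulrA mulVf ?gt_eqF // mulr1.
- by move=> s; case: (FP s) => _ [? []].
- apply: same (FP 0) _; have -> : z 0 = x.
    by rewrite /z /clamp min_l ?(ltW l0) // maxxx mul0r scale0r addr0.
  by apply: graph_point_self; rewrite // subrr enorm0 ltW ?arc_radius_gt0.
- apply: same (FP l) _; have -> : z l = y.
    by rewrite /z /clamp minxx max_r ?(ltW l0) // divff ?gt_eqF // scale1r addrC subrK.
  exact: graph_point_self.
Qed.

End Graph.

Definition level_arc_const : R := chain_const n rad arc_radius arc_ratio.

Lemma level_arc_const_gt0 : 0 < level_arc_const.
Proof.
by rewrite /level_arc_const /chain_const mulr_gt0 ?arc_ratio_gt0 // ltr_wpDl ?mulr_ge0.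
Qed.

Lemma level0_arc x y : connected [set z | g z = 0] -> g x = 0 -> g y = 0 ->
  arc [set z | g z = 0] x y (level_arc_const * enorm (y - x)).
Proof.
move=> conn gx gy.
apply: (chain_arc arc_radius_gt0 arc_ratio_gt0 _ conn) => //.
  by move=> z /= gz; exact: (level0_lt_rad H gz).
by move=> x' y' gx' gy' xy; exact: level_arc.
Qed.

Lemma quasiconvex_level a (K K' : R) : 0 < K -> 0 <= K' ->
  connected [set z | g z = 0] ->
  bilipschitz_projection K K' [set z | g z = 0] [set z | g z = - a] ->
  quasiconvex (K * (level_arc_const * K')) [set z | g z = - a].
Proof.
move=> K0 K'0 conn [P [Q [_ [PS _ Psurj] Plip QP Qlip]]].
have c0 := level_arc_const_gt0.
apply: quasiconvex_arc => [|p q gp gq]; first exact: mulr_ge0 (ltW K0) (mulr_ge0 (ltW c0) K'0).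
have [x gx xp] := Psurj p gp; have [y gy yq] := Psurj q gq.
have yx : enorm (y - x) <= K' * enorm (q - p).
  by rewrite -(QP x gx) -(QP y gy) xp yq; exact: Qlip.
rewrite -xp -yq -(mulrA K) -(mulrA _ K').
have := arc_map K0 Plip PS (level0_arc conn gx gy); apply: arc_le.
  exact: mulr_ge0 (ltW K0) (mulr_ge0 (ltW c0) (enorm_ge0 _)).
rewrite xp yq; apply: (ler_wpM2l (ltW K0)); exact: (ler_wpM2l (ltW c0)).
Qed.

End LevelArcs.

(** * Uniformity in time *)

Section UniformGradient.
Variables (R : realType) (n : nat) (T Mt L rad kappa : R) (psi : R -> 'rV[R]_n -> R).
Hypotheses (Mt_gt0 : 0 < Mt) (L_gt0 : 0 < L) (rad_gt0 : 0 < rad).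
Hypothesis psi_diff : forall t, t \in `[0, T] ->
  forall x, differentiable (psi t : 'rV[R]_n -> R^o) x.
Hypothesis psi_lip : forall t, t \in `[0, T] ->
  elipschitz_on L (eball (2 * rad)) (grad (psi t)).
Hypothesis psi_in : forall t x, t \in `[0, T] -> psi t x <= 0 -> enorm x < rad.
Hypothesis psi_t : forall t s x, t \in `[0, T] -> s \in `[0, T] ->
  enorm x < 2 * rad -> `|psi t x - psi s x| <= Mt * `|t - s|.
Hypothesis psi_grad : forall t x, t \in `[0, T] -> psi t x = 0 ->
  kappa < enorm (grad (psi t) x).

Lemma continuous_enorm t x e : t \in `[0, T] -> 0 < e ->
  exists2 d, 0 < d & forall y, enorm (y - x) < d -> `|psi t y - psi t x| < e.
Proof.
move=> tT e0; have /cvgrPdist_lt/(_ e e0) := continuous_diff (psi_diff tT) (x := x).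
move=> /nbhs_enormP[d d0 dP]; exists d => // y yx; rewrite distrC; exact: dP.
Qed.

(** The hypotheses compare values of [psi] at different times, but not gradients. Gradients are
    therefore compared through increments by a fixed [w], whose end values are both approximated
    here. *)
Lemma cluster_near (p : nat -> R * 'rV[R]_n) t x : t \in `[0, T] -> enorm x <= rad ->
  (forall j, (p j).1 \in `[0, T] /\ enorm (p j).2 < rad) ->
  cluster (p @ \oo) (t, x) ->
  forall w e, enorm w < rad -> 0 < e -> exists j,
    [/\ `|psi (p j).1 (p j).2 - psi t x| <= e,
        `|psi (p j).1 ((p j).2 + w) - psi t (x + w)| <= e &
        j.+1%:R^-1 <= e].
Proof.
move=> tT xr pT clu w e wr e0.
have e2 : 0 < e / 2 by rewrite divr_gt0.
have [d1 d10 d1P] := continuous_enorm x tT e2.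
have [d2 d20 d2P] := continuous_enorm (x + w) tT e2.
pose N := Num.truncn e^-1.
have tail : (p @ \oo) [set q | exists2 j, (N <= j)%N & q = p j].
  by exists N => // j Nj; exists j.
have e3 : 0 < e / (2 * Mt) by rewrite divr_gt0 // mulr_gt0.
have nb : nbhs (t, x) [set q : R * 'rV[R]_n | `|t - q.1| < e / (2 * Mt) /\
    enorm (q.2 - x) < Num.min d1 d2].
  exists ([set s | `|t - s| < e / (2 * Mt)], [set y | enorm (y - x) < Num.min d1 d2]).
    split; first by apply: nbhs_norm_le_nbhs; exists (e / (2 * Mt)).
    by apply/nbhs_enormP; exists (Num.min d1 d2); rewrite // lt_min d10.
  by move=> [s y] /= [].
have [_ [[j Nj ->] /= [tj]]] := clu _ _ tail nb.
rewrite lt_min => /andP[x1 x2]; have [pjT pjr] := pT j.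
have Mtj : Mt * `|(p j).1 - t| <= e / 2.
  by rewrite distrC mulrC -ler_pdivlMr // -mulrA -invfM ltW.
exists j; split.
- have h1 := d1P _ x1.
  have h2 : `|psi (p j).1 (p j).2 - psi t (p j).2| <= Mt * `|(p j).1 - t|.
    by apply: psi_t => //; move: rad_gt0; lra.
  by have := ler_distD (psi t (p j).2) (psi (p j).1 (p j).2) (psi t x); lra.
- have h1 : `|psi t ((p j).2 + w) - psi t (x + w)| < e / 2.
    by apply: d2P; rewrite opprD addrACA subrr addr0.
  have h2 : `|psi (p j).1 ((p j).2 + w) - psi t ((p j).2 + w)| <= Mt * `|(p j).1 - t|.
    by apply: psi_t => //; have := enorm_triangle (p j).2 w; lra.
  by have := ler_distD (psi t ((p j).2 + w)) (psi (p j).1 ((p j).2 + w)) (psi t (x + w)); lra.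
- rewrite -[leRHS]invrK lef_pV2 ?posrE ?invr_gt0 //.
  have e1 : 0 <= e^-1 by rewrite invr_ge0 ltW.
  have /andP[_ eN] := truncn_itv e1.
  by apply: ltW; apply: lt_le_trans eN _; rewrite ler_nat.
Qed.

(** Otherwise points with values in [[- j.+1%:R^-1, 0]] and gradient norm at most [kappa] cluster at
    some [(t, x)] with [psi t x = 0]. A small increment along the gradient there is too large to be
    the limit of increments at those points. *)
Lemma uniform_gradient_bound : exists2 eps : R, 0 < eps &
  forall t x, t \in `[0, T] -> - eps <= psi t x -> psi t x <= 0 ->
    kappa < enorm (grad (psi t) x).
Proof.
apply: contrapT => noeps.
have bad (j : nat) : exists q : R * 'rV[R]_n, [/\ q.1 \in `[0, T],
    - j.+1%:R^-1 <= psi q.1 q.2, psi q.1 q.2 <= 0 & enorm (grad (psi q.1) q.2) <= kappa].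
  apply: contrapT => nq; apply: noeps; exists j.+1%:R^-1; first by rewrite invr_gt0.
  move=> t x tT h1 h2; rewrite ltNge; apply/negP => h3; apply: nq.
  by exists (t, x).
have [p pP] := choice bad.
have pT j : (p j).1 \in `[0, T] /\ enorm (p j).2 < rad.
  by have [h1 _ h2 _] := pP j; split=> //; exact: psi_in h1 h2.
pose K : set (R * 'rV[R]_n) := `[0, T]%classic `*` [set x | enorm (x - 0) <= rad].
have Kc : compact K.
  apply: compact_setX; first exact: segment_compact.
  apply: (@closed_eball_compact _ _ _ (rad + 1)); first exact: closed_enorm_le.
  by move=> x /=; rewrite subr0 /eball /= => /le_lt_trans; apply; rewrite ltrDl.
have FK : (p @ \oo) K.
  by exists 0%N => // j _; have [h1 h2] := pT j; split => //=; rewrite subr0 ltW.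
have [[t x] [[/= tT]]] := Kc (p @ \oo) _ FK.
rewrite subr0 => xr clu.
have near_tx := cluster_near tT xr pT clu.
have psi0 : psi t x = 0.
  apply/eqP; rewrite -normr_le0; apply/ler_addgt0Pr => e e0; rewrite add0r.
  have e2 : 0 < e / 2 by rewrite divr_gt0.
  have [|j [h1 _ h2]] := near_tx 0 (e / 2) _ e2; first by rewrite enorm0.
  have [_ h3 h4 _] := pP j; have h3' : - psi (p j).1 (p j).2 <= j.+1%:R^-1.
    by rewrite lerNl.
  move: h1; rewrite distrC => h1.
  have := ler_normD (psi t x - psi (p j).1 (p j).2) (psi (p j).1 (p j).2).
  have := le_trans h3' h2; rewrite subrK (ler0_norm h4); lra.
have := psi_grad tT psi0; set v := grad (psi t) x => kv.
have k0 : 0 <= kappa by have [_ _ _ h] := pP 0%N; exact: le_trans (enorm_ge0 _) h.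
have v0 : 0 < enorm v by lra.
pose gap := enorm v - kappa.
have gap0 : 0 < gap by rewrite subr_gt0.
(* Each of the two first-order errors is at most [h * gap / 4], and the two approximations cost
   [h * gap / 8] each; the total stays below [h * gap]. *)
pose h := Num.min (rad / 2) (gap / (4 * L)).
have h0 : 0 < h by rewrite lt_min !divr_gt0 ?mulr_gt0.
have hr : h <= rad / 2 by rewrite ge_min lexx.
have hgap : h * (4 * L) <= gap by rewrite -ler_pdivlMr ?mulr_gt0 // ge_min lexx orbT.
pose w := (h / enorm v) *: v.
have wE : enorm w = h.
  by rewrite /w enormZ ger0_norm ?divr_ge0 ?(ltW h0) ?(ltW v0) // divfK // gt_eqF.
have e0 : 0 < h * gap / 8 by rewrite divr_gt0 // mulr_gt0.
have [|j [h1 h2 _]] := near_tx w _ _ e0; first by rewrite wE; move: rad_gt0; lra.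
have [pjT pjr] := pT j; have [_ _ _ gj] := pP j.
have fo s y : s \in `[0, T] -> enorm y <= rad ->
    `|psi s (y + w) - psi s y - dotv (grad (psi s) y) w| <= L * h ^+ 2.
  move=> sT yr; have yr2 : enorm y < 2 * rad by move: rad_gt0; lra.
  have ywr : enorm (y + w) < 2 * rad.
    by have := enorm_triangle y w; rewrite wE; move: rad_gt0; lra.
  have := first_order (psi_diff sT) (ltW L_gt0) (psi_lip sT) yr2 ywr.
  by rewrite (addrC y) addrK wE.
have := fo _ _ tT xr; have := fo _ _ pjT (ltW pjr).
have vw : dotv v w = h * enorm v.
  by rewrite /w dotvZr -enorm_sqr expr2 mulrA divfK // gt_eqF.
have gw : dotv (grad (psi (p j).1) (p j).2) w <= kappa * h.
  by apply: le_trans (dotv_le _ _) _; rewrite wE ler_pM2r.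
have Lh : L * h ^+ 2 <= h * gap / 4.
  have -> : L * h ^+ 2 = h * (h * (4 * L)) / 4 by field.
  by rewrite ler_pM2r ?invr_gt0 // ler_pM2l.
have hg : h * gap = h * enorm v - kappa * h by rewrite /gap; ring.
rewrite -/v vw !ler_norml; move: h1 h2; rewrite !ler_norml.
move=> /andP[a1 a2] /andP[b1 b2] /andP[c1 c2] /andP[d1 d2].
have := mulr_gt0 h0 gap0; lra.
Qed.

End UniformGradient.

(** * Positivity and decay of the levels *)

(** The lower bound on [gamma k] makes the argument of the logarithm at least [expR 1], hence above
    1. *)
Lemma alpha_of_gt0 (R : realType) (eta M : R) (gamma : nat -> R) k :
  0 < eta -> 0 < M -> 2 * M * expR 1 / eta <= gamma k -> 0 < alpha_of eta M gamma k.
Proof.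
move=> eta0 M0 gk.
have g0 : 0 < gamma k.
  by apply: lt_le_trans gk; rewrite divr_gt0 // !mulr_gt0 ?expR_gt0.
rewrite /alpha_of divr_gt0 //; apply: ln_gt0.
apply: (@lt_le_trans _ _ (expR 1)); first by rewrite expR_gt1.
rewrite ler_pdivlMr ?mulr_gt0 //.
by move: gk; rewrite ler_pdivrMr // mulrC (mulrC eta).
Qed.

(** Since [ln y = 2 * ln (Num.sqrt y) <= 2 * Num.sqrt y], the level is at most
    [2 * Num.sqrt (c / gamma k)]. *)
Lemma alpha_of_small (R : realType) (eta M : R) (gamma : nat -> R) (e : R) :
  0 < eta -> 0 < M -> gamma @ \oo --> +oo -> 0 < e ->
  \forall k \near \oo, alpha_of eta M gamma k <= e.
Proof.
move=> eta0 M0 /cvgryPge glim e0; pose c := eta / (2 * M).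
have c0 : 0 < c by rewrite divr_gt0 // mulr_gt0.
have K0 : 0 < 4 * c / e ^+ 2.
  by apply: divr_gt0 (exprn_gt0 _ e0); exact: mulr_gt0.
apply: filterS (glim (4 * c / e ^+ 2)) => k gk.
have g0 : 0 < gamma k := lt_le_trans K0 gk.
rewrite /alpha_of ler_pdivrMr //.
have -> : eta * gamma k / (2 * M) = c * gamma k by rewrite /c; field; rewrite gt_eqF.
set y := c * gamma k; have y0 : 0 < y by rewrite mulr_gt0.
have s0 : 0 < Num.sqrt y by rewrite sqrtr_gt0.
have -> : ln y = 2 * ln (Num.sqrt y).
  by rewrite -{1}(sqr_sqrtr (ltW y0)) lnXn // mulr_natl.
apply: (@le_trans _ _ (2 * Num.sqrt y)).
  by rewrite ler_pM2l // ltW // ln_sublinear.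
rewrite -(@ler_pXn2r _ 2) ?nnegrE ?mulr_ge0 ?(ltW s0) ?(ltW e0) ?(ltW g0) //.
rewrite !exprMn sqr_sqrtr ?(ltW y0) // /y.
move: gk; rewrite ler_pdivrMr ?exprn_gt0 // => gk.
have := ler_wpM2r (ltW g0) gk; lra.
Qed.

(** Put all the weight of the convex combination on the index [i]. *)
Lemma grad_gt_of_nondegenerate (R : realType) (n r : nat)
    (psi : 'I_r -> 'rV[R]_n -> R) (eta : R) (c : 'rV[R]_n) :
  ((exists i, psi i c = 0) -> forall lambda : 'I_r -> R,
     (forall i, psi i c = 0 -> 0 <= lambda i) ->
     \sum_(i < r | psi i c == 0) lambda i = 1 ->
     2 * eta < enorm (\sum_(i < r | psi i c == 0) lambda i *: grad (psi i) c)) ->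
  forall i, psi i c = 0 -> 2 * eta < enorm (grad (psi i) c).
Proof.
move=> nondeg i ic; have := nondeg (ex_intro _ i ic) (fun j => (j == i)%:R).
rewrite (bigD1 i) ?ic //= eqxx big1 ?addr0; last first.
  by move=> j /andP[_ /negPf ->].
rewrite (bigD1 i) ?ic //= eqxx scale1r big1 ?addr0; last first.
  by move=> j /andP[_ /negPf ->]; rewrite scale0r.
by apply=> // j _; rewrite ler0n.
Qed.

(** * Constants common to all times and indices, and the five assertions *)

Unset Implicit Arguments.
Set Strict Implicit.
Set Printing Implicit Defensive.

Theorem proposition5p2 (R : realType) (T : R) (n m r : nat)
  (U : set 'rV[R]_m) (f : 'rV[R]_n -> 'rV[R]_m -> 'rV[R]_n)
  (psi : 'I_r -> R -> 'rV[R]_n -> R)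
  (Mt Mpsi rad eta M0 M : R) (gamma : nat -> R)
  (hT : 0 < T) (hn : (0 < n)%N) (hm : (0 < m)%N) (hr : (0 < r)%N)
  (hU0 : U !=set0) (hUc : compact U)
  (hMt : 0 < Mt) (hMpsi : 0 < Mpsi) (hrad : 0 < rad) (heta : 0 < eta)
  (hM0 : 0 < M0)
  (hC0 : forall t : R, t \in `[0, T] -> Call psi t !=set0)
  (hpsi_cont : forall i,
     {within [set p : R * 'rV[R]_n | p.1 \in `[0, T]],
       continuous (fun p : R * 'rV[R]_n => psi i p.1 p.2)})
  (hpsi_C11 : forall i (t : R), t \in `[0, T] -> C11 (psi i t))
  (hbdry : (1 < n)%N ->
     forall i (t : R), t \in `[0, T] -> connected (bdry (Ci psi i t)))
  (hconv : n = 1%N ->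
     forall i (t : R), t \in `[0, T] ->
       convex_set (Ci psi i t : set (convex_lmodType 'rV[R]_n)))
  (hball : forall i (t : R), t \in `[0, T] -> Ci psi i t `<=` eball rad)
  (hpsi_t : forall i (t s : R) x, t \in `[0, T] -> s \in `[0, T] ->
     eball (2 * rad) x -> `|psi i t x - psi i s x| <= Mt * `|t - s|)
  (hpsi_grad : forall i (t : R), t \in `[0, T] ->
     elipschitz_on (2 * Mpsi) (eball (2 * rad)) (grad (psi i t)))
  (hnondeg : forall (t : R) c, t \in `[0, T] ->
     (exists i, psi i t c = 0) ->
     forall lambda : 'I_r -> R,
       (forall i, psi i t c = 0 -> 0 <= lambda i) ->
       \sum_(i < r | psi i t c == 0) lambda i = 1 ->
       2 * eta <
         enorm (\sum_(i < r | psi i t c == 0) lambda i *: grad (psi i t) c))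
  (hMpsi_eta : eta / rad <= Mpsi)
  (hf_cont : {within (Cunion psi T `*` U),
     continuous (fun p : 'rV[R]_n * 'rV[R]_m => f p.1 p.2)})
  (hf_bnd : forall x u, Cunion psi T x -> U u -> enorm (f x u) <= M0)
  (hf_lip : forall u, U u ->
     elipschitz_on M0 (Cunion psi T) (fun x => f x u))
  (hM : M = M0 + Mt / eta)
  (hgamma : forall k, 2 * M * expR 1 / eta <= gamma k)
  (hgamma_lim : gamma @ \oo --> +oo) :
  let alpha := alpha_of eta M gamma in
  let C := Ci psi in
  let Ck := Cik psi alpha in
  [/\ forall (t : R) k i, t \in `[0, T] ->
        compact (Ck i t k) /\ Ck i t k `<=` (C i t)°,
      forall i,
        (fun k => ereal_sup [set ereal_sup
           [set edistance c (bdry (Ck i t k)) | c in bdry (C i t)]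
           | t in `[0, T]]) @ \oo --> (0 : \bar R) &
      exists k1 : nat,
        (forall k (t : R) i, (k1 <= k)%N -> t \in `[0, T] ->
          [/\ bdry (Ck i t k) = [set x | psi i t x = - alpha k] /\
              bdry (Ck i t k) !=set0,
              (Ck i t k)° = [set x | psi i t x < - alpha k] /\
              (Ck i t k)° !=set0,
              prox_regular (Ck i t k) (eta / (4 * Mpsi)),
              Ck i t k = closure (Ck i t k)° &
              forall x, bdry (Ck i t k) x ->
                [/\ clarke_normal_cone (Ck i t k) x =
                      proximal_normal_cone (Ck i t k) x,
                    proximal_normal_cone (Ck i t k) x =
                      limiting_normal_cone (Ck i t k) x &
                    limiting_normal_cone (Ck i t k) x =
                      [set lambda *: grad (psi i t) x
                        | lambda in [set lambda : R | 0 <= lambda]]]]) /\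
        exists k2 : nat,
          [/\ (k1 <= k2)%N,
              exists L L' : R, forall k (t : R) i, (k2 <= k)%N -> t \in `[0, T] ->
                bilipschitz_projection L L' (bdry (C i t)) (bdry (Ck i t k)) &
              (1 < n)%N -> exists2 beta : R, 0 < beta &
                forall k (t : R) i, (k2 <= k)%N -> t \in `[0, T] ->
                  quasiconvex beta (bdry (Ck i t k))]].
Proof.
move=> alpha C Ck.
have M_gt0 : 0 < M by rewrite hM addr_gt0 // divr_gt0.
have alpha_gt0 k : 0 < alpha k by exact: alpha_of_gt0.
have alpha_ge0 k : 0 <= alpha k by exact: ltW.
have alpha_small e : 0 < e -> \forall k \near \oo, alpha k <= e.
  by move=> e0; exact: alpha_of_small.
have L_gt0 : 0 < 2 * Mpsi by rewrite mulr_gt0.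
have [e_ e_gt0 e_P] : exists2 e_ : 'I_r -> R, forall i, 0 < e_ i &
    forall i t x, t \in `[0, T] -> - e_ i <= psi i t x -> psi i t x <= 0 ->
    2 * eta < enorm (grad (psi i t) x).
  suff /choice[e_ e_P] : forall i, exists e : R, 0 < e /\
      forall t x, t \in `[0, T] -> - e <= psi i t x -> psi i t x <= 0 ->
      2 * eta < enorm (grad (psi i t) x).
    by exists e_ => i; have [] := e_P i.
  move=> i; have [] := @uniform_gradient_bound R n T Mt (2 * Mpsi) rad (2 * eta)
    (psi i) hMt L_gt0 hrad.
  - by move=> t tT; exact: (hpsi_C11 i t tT).1.
  - exact: hpsi_grad.
  - by move=> t x tT; exact: hball.
  - exact: hpsi_t.
  - move=> t x tT; apply: (@grad_gt_of_nondegenerate R n r (fun i => psi i t)).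
    exact: hnondeg.
  - by move=> e e0 eP; exists e.
(* A minimum over finitely many indices makes the band width independent of [i] as well as of
   [t]. *)
pose eps := \big[Num.min/1]_i e_ i.
have eps_gt0 : 0 < eps.
  by rewrite /eps; elim/big_ind: _ => // x y x0 y0; rewrite lt_min x0.
have eps_le i : eps <= e_ i by exact: bigmin_le_cond.
have reg i t : t \in `[0, T] -> regular_sublevel (psi i t) rad (2 * Mpsi) eta eps.
  move=> tT; split => //.
  - exact: (hpsi_C11 i t tT).1.
  - exact: hpsi_grad.
  - by move=> x; exact: hball.
  - by have [x /(_ i I)] := hC0 t tT; exists x.
  - move=> x ex; apply: e_P => //; apply: le_trans ex; by rewrite lerN2.
have bdryC i t : t \in `[0, T] -> bdry (C i t) = [set x | psi i t x = 0].
  move=> tT; have := bdry_sublevel (reg i t tT) (lexx 0) (ltW eps_gt0).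
  by rewrite oppr0.
have intC i t : t \in `[0, T] -> (C i t)° = [set x | psi i t x < 0].
  move=> tT; have := interior_sublevel (reg i t tT) (lexx 0) (ltW eps_gt0).
  by rewrite oppr0.
(* Levels below [eps] suffice for the normal cones; the second entry is the smallness that the
   projection requires. *)
pose thr := Num.min eps (2 * eta ^+ 2 / (3 * (2 * Mpsi))).
have thr_gt0 : 0 < thr by rewrite lt_min eps_gt0 divr_gt0 // !mulr_gt0 // exprn_gt0.
have thr_le a : a <= thr -> a <= eps /\ a * (3 * (2 * Mpsi)) <= 2 * eta ^+ 2.
  by rewrite le_min => /andP[-> h]; split=> //; rewrite -ler_pdivlMr // !mulr_gt0.
split.
- move=> t k i tT; split.
    by apply: (compact_sublevel (reg i t tT)); rewrite oppr_le0.
  rewrite intC // => x /le_lt_trans; apply; by rewrite oppr_lt0.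
- move=> i.
  have alpha_lim : (fun k => (alpha k / eta)%:E) @ \oo --> (0 : \bar R).
    apply: cvg_EFin; first by apply: nearW.
    apply/cvgrPdist_le => e e0; apply: filterS (alpha_small (e * eta) _) => [k ke|].
      rewrite sub0r normrN (ger0_norm (divr_ge0 (alpha_ge0 k) (ltW heta))).
      by rewrite ler_pdivrMr.
    by rewrite mulr_gt0.
  apply: squeeze_cvge (cvg_cst (0 : \bar R)) alpha_lim.
  apply: filterS (alpha_small _ thr_gt0) => k /thr_le[ke kt].
  have T0 : (0 : R) \in `[0, T] by rewrite in_itv /= lexx ltW.
  have dist_le t c : t \in `[0, T] -> psi i t c = 0 ->
      (edistance c (bdry (Ck i t k)) <= (alpha k / eta)%:E)%E.
    move=> tT ic; rewrite (bdry_sublevel (reg i t tT) (alpha_ge0 k) ke).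
    have [p [lambda [[gp _ _ _ _] cp]]] := foot_exists (reg i t tT) (alpha_ge0 k) ke kt ic.
    apply: (@le_trans _ _ (enorm (c - p))%:E); last by rewrite lee_fin ler_pdivlMr.
    by apply: ereal_inf_lbound; exists p.
  apply/andP; split.
    (* A supremum over the empty set would be [-oo], so the lower bound 0 needs an actual boundary
       point, taken at time 0. *)
    have [c ic] := level_neq0 hn (reg i 0 T0) (lexx 0) (ltW eps_gt0).
    rewrite oppr0 in ic.
    apply: (@le_trans _ _ (edistance c (bdry (Ck i 0 k)))).
      by apply: le_ereal_inf_tmp => _ [s _ <-]; rewrite lee_fin enorm_ge0.
    apply: le_ereal_sup_tmp; eexists; first by exists 0.
    by apply: ereal_sup_ubound; exists c; rewrite // bdryC.
  apply: ge_ereal_sup => _ [t tT <-]; apply: ge_ereal_sup => _ [c cb <-].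
  by rewrite bdryC // in cb; exact: dist_le.
have [k1 _ k1P] := alpha_small _ eps_gt0.
have [k2 _ k2P] := alpha_small _ thr_gt0.
have bdryCk k t i : alpha k <= eps -> t \in `[0, T] ->
    bdry (Ck i t k) = [set x | psi i t x = - alpha k].
  by move=> ke tT; exact: (bdry_sublevel (reg i t tT) (alpha_ge0 k) ke).
exists k1; split.
  move=> k t i /k1P ke tT; have Hit := reg i t tT.
  rewrite bdryCk //; split.
  - by split=> //; exact: (level_neq0 hn Hit (alpha_ge0 k) ke).
  - split; first exact: (interior_sublevel Hit (alpha_ge0 k) ke).
    exact: (interior_sublevel_neq0 Hit (alpha_ge0 k) ke).
  - have -> : 4 * Mpsi = 2 * (2 * Mpsi) by ring.
    exact: (prox_regular_sublevel Hit (alpha_ge0 k) ke).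
  - exact: (closure_interior_sublevel Hit (alpha_ge0 k) ke).
  - by move=> x xk; exact: (normal_cones_sublevel Hit (alpha_ge0 k) ke xk).
have bilip k t i : (maxn k1 k2 <= k)%N -> t \in `[0, T] ->
    bilipschitz_projection 3 (foot_inverse_lip rad (2 * Mpsi) eta)
      [set x | psi i t x = 0] [set x | psi i t x = - alpha k].
  rewrite geq_max => /andP[_ /k2P /thr_le[ke kt]] tT.
  exact: (bilipschitz_level (reg i t tT) (alpha_ge0 k) ke kt).
have bdryCk2 k t i : (maxn k1 k2 <= k)%N -> t \in `[0, T] ->
    bdry (Ck i t k) = [set x | psi i t x = - alpha k].
  by rewrite geq_max => /andP[/k1P ke _]; exact: bdryCk.
exists (maxn k1 k2); split; first exact: leq_maxl.
  exists 3, (foot_inverse_lip rad (2 * Mpsi) eta) => k t i kk tT.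
  by rewrite bdryC // bdryCk2 //; exact: bilip.
move=> n_gt1; set K' := foot_inverse_lip rad (2 * Mpsi) eta in bilip *.
have K'0 : 0 < K'.
  rewrite /K' /foot_inverse_lip mulr_gt0 // ltr_wpDr //.
  by rewrite divr_ge0 ?sqr_ge0 // mulr_ge0 // sqr_ge0.
exists (3 * (level_arc_const n rad (2 * Mpsi) eta * K')).
  have T0 : (0 : R) \in `[0, T] by rewrite in_itv /= lexx ltW.
  apply: mulr_gt0 => //.
  (* The constant depends neither on the time nor on the index; its positivity is read off at time 0
     for the first index. *)
  exact: mulr_gt0 (level_arc_const_gt0 (reg (Ordinal hr) 0 T0)) K'0.
move=> k t i kk tT; rewrite bdryCk2 //.
apply: (quasiconvex_level (reg i t tT) _ (ltW K'0) _ (bilip k t i kk tT)) => //.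
by rewrite -bdryC //; exact: hbdry.
Qed.
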